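(* Let $\mathbb{K}$ be an algebraically closed field, let $I\subset\mathbb{K}[x_1,\ldots,x_n]$ be an ideal, let $\Sigma$ be a regular refinement of the Gröbner fan $\Sigma(I)$, and let $\widetilde{V(I)}$ be the strict transform of $V(I)$ under the toric modification $\pi:X_\Sigma\to\mathbb{K}^n$ given by $\Sigma$. Then for every $\tau\in\Sigma$, $$\widetilde{V(I)}\cap\mathcal{O}(\tau)\neq\emptyset\iff\tau\subset\mathbf{TV}(I).$$
   Context: Notation: $\mathbb{K}^*=\mathbb{K}\setminus\{0\}$; $e^{(1)},\ldots,e^{(n)}$ is the standard basis of $\mathbb{R}^n$; $V(I)\subset\mathbb{K}^n$ is the zero set of $I$. Initial ideals. For a nonzero polynomial $f=\sum_\mu a_\mu x^\mu$ with support $\varepsilon(f)=\{\mu: a_\mu\neq 0\}$ and a weight vector $\omega$, put $\nu_\omega(f)=\min\{\omega\cdot\mu:\mu\in\varepsilon(f)\}$ and $In_\omega f=\sum_{\mu\in\varepsilon(f),\ \omega\cdot\mu=\nu_\omega(f)}a_\mu x^\mu$. For an ideal $I$, $\mathfrak{In}_\omega I$ is the ideal generated by $\{In_\omega f: f\in I\setminus\{0\}\}$. Tropical variety. $\mathbf{TV}(I)=\{\omega\in\mathbb{R}^n:\mathfrak{In}_\omega I\text{ contains no monomial}\}$. Gröbner fan. For $\omega\in\mathbb{R}^n$ let $C_\omega(I)$ be the closure in $\mathbb{R}^n$ of $\{u\in\mathbb{R}^n:\mathfrak{In}_uI=\mathfrak{In}_\omega I\}$; it is taken as known that these are polyhedral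 cones and that $\Sigma'(I)=\{C_\omega(I):\omega\in\mathbb{R}^n\}$ is a fan. The Gröbner fan of $I$ is $\Sigma(I)=\{C\cap E_J: C\in\Sigma'(I),\ J\subset\{1,\ldots,n\}\}$, where $E_J$ is the cone generated by $\{e^{(j)}:j\in J\}$; its support is the first orthant $(\mathbb{R}_{\ge0})^n$. Fans. A fan is a collection of polyhedral cones containing all faces of its members and such that the intersection of any two members is a face of each. A rational strongly convex cone is regular if the primitive integer generators of its rays form a $\mathbb{Z}$-basis of the intersection of its linear span with $\mathbb{Z}^n$. A regular refinement of a fan $\Sigma_0$ is a fan $\Sigma$, all of whose cones are regular, such that every cone of $\Sigma_0$ is a union of cones of $\Sigma$. $Cone(M)$ is the cone whose vertices (primitive ray generators) are the columns of $M$. Toric modification. For $M\in GL(n,\mathbb{Z})$ with columns $u^{(1)},\ldots,u^{(n)}$ put $\phi_M(z)=(z^{u^{(1)}},\ldots,z^{u^{(n)}})$ on $(\mathbb{K}^* )^n$. Let $\Sigma$ be a regular fan with support the first orthant. For each $n$-dimensional cone $\sigma=Cone(M)\in\Sigma$ (with $M\in GL(n,\mathbb{Z})$) take a copy $U_\sigma$ of $\mathbb{K}^n$. The variety $X_\Sigma$ is the quotient of the disjoint union of the $U_\sigma$ by the relation identifying $u\in U_\sigma$, $\sigma=Cone(M)$, with $u'\in U_{\sigma'}$, $\sigma'=Cone(M')$, if and only if the birational map $\phi_{M^t(M'^{-1})^t}:U_\sigma\dashrightarrow U_{\sigma'}$ is biregular at $u$ and sends $u$ to $u'$. The toric modification $\pi:X_\Sigma\to\mathbb{K}^n$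 is given on each chart $U_\sigma$, $\sigma=Cone(M)$, by $x\mapsto\phi_{M^t}(x)$. Orbits. If $\sigma=Cone(M)\in\Sigma$ is $n$-dimensional and $\tau$ is the face of $\sigma$ generated by the $i$-th columns of $M$ with $i\in\lambda\subset\{1,\ldots,n\}$, then $\mathcal{O}(\tau)=\{(x_1,\ldots,x_n)\in U_\sigma: x_i=0\text{ for }i\in\lambda,\ x_i\neq0\text{ for }i\notin\lambda\}$; as a subset of $X_\Sigma$ this does not depend on the choice of $\sigma$. Strict transform. With $V^*=V\setminus V(x_1\cdots x_n)$, the strict transform of $V$ is $\widetilde V=\overline{\pi^{-1}(V^* )}$ (Zariski closure in $X_\Sigma$). *)

(* Defs.v *)
From HB Require Import structures.
From mathcomp Require Import all_boot all_order all_algebra.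
From mathcomp Require Import generic_quotient.
From mathcomp Require Import boolp classical_sets cardinality reals topology.
From mathcomp Require Import mpoly.

Set Implicit Arguments.
Unset Strict Implicit.
Unset Printing Implicit Defensive.

Import Order.TTheory GRing.Theory Num.Theory.
Import numFieldTopology.Exports.
Local Open Scope ring_scope.
Local Open Scope classical_set_scope.
Local Open Scope quotient_scope.

(* Vectors of R^n, Z^n and K^n are columns. *)

Section PolyhedralCones.
Variables (R : realType) (n : nat).
Implicit Types (C F : set 'cV[R]_n).

Definition realmx m k (A : 'M[int]_(m, k)) : 'M[R]_(m, k) := map_mx intr A.

Definition cone k (A : 'M[R]_(n, k)) : set 'cV[R]_n :=
  [set A *m c | c in [set c : 'cV[R]_k | forall i, 0 <= c i 0]].

(* The cone generated by the columns of A with index in J. *)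
Definition subcone k (A : 'M[R]_(n, k)) (J : {set 'I_k}) : set 'cV[R]_n :=
  cone (colsub (fun i : 'I_#|J| => enum_val i) A).

Definition polyhedral_cone C := exists k (A : 'M[R]_(n, k)), C = cone A.

Definition rational_cone C :=
  exists k (A : 'M[int]_(n, k)), C = cone (realmx A).

Definition strongly_convex C := forall u, C u -> C (- u) -> u = 0.

Definition dotv (a u : 'cV[R]_n) : R := \sum_i a i 0 * u i 0.

Definition is_face F C :=
  exists2 a, (forall u, C u -> 0 <= dotv a u) &
             F = C `&` [set u | dotv a u = 0].

Definition linear_span C : set 'cV[R]_n :=
  [set u | exists k (A : 'M[R]_(n, k)),
    (forall j, C (col j A)) /\ exists c : 'cV[R]_k, u = A *m c].

Definition primitive_vec (v : 'cV[int]_n) :=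
  \big[gcdn/0%N]_(i < n) absz (v i 0) = 1%N.

Definition primitive_ray_generator C (v : 'cV[int]_n) :=
  primitive_vec v /\ is_face (cone (realmx v)) C.

(* The columns of P are the primitive generators of the rays of C, and they
   are a Z-basis of the lattice linear_span C \cap Z^n. *)
Definition regular_cone C :=
  [/\ rational_cone C, strongly_convex C &
      exists k (P : 'M[int]_(n, k)),
        (forall v, primitive_ray_generator C v <-> exists j, v = col j P) /\
        (forall w : 'cV[int]_n, linear_span C (realmx w) ->
           exists! c : 'cV[int]_k, w = P *m c)].

Implicit Types S : set (set 'cV[R]_n).

Definition is_fan S :=
  [/\ finite_set S,
      (forall C, S C -> polyhedral_cone C),
      (forall C F, S C -> is_face F C -> S F) &
      (forall C D, S C -> S D -> is_face (C `&` D) C /\ is_face (C `&` D) D)].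

Definition fan_support S : set 'cV[R]_n := \bigcup_(C in S) C.

Definition orthant : set 'cV[R]_n := [set u | forall i, 0 <= u i 0].

Definition regular_refinement S0 S :=
  [/\ is_fan S,
      (forall C, S C -> regular_cone C) &
      (forall C, S0 C -> exists2 T, T `<=` S & C = \bigcup_(D in T) D)].

End PolyhedralCones.

Arguments orthant : clear implicits.

Section InitialIdeals.
Variables (R : realType) (K : fieldType) (n : nat).
Implicit Types (I G : set {mpoly K[n]}) (w u : 'cV[R]_n) (f : {mpoly K[n]}).

Definition is_ideal I :=
  [/\ I 0, (forall f g, I f -> I g -> I (f + g)) &
      (forall f g, I g -> I (f * g))].

Definition ideal_gen G : set {mpoly K[n]} := smallest is_ideal G.

Definition wdot w (m : 'X_{1..n}) : R := \sum_i w i 0 *+ m i.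

(* mlead f only provides an element of the support of f != 0 over which the
   minimum is taken. *)
Definition weight_order w f : R :=
  \big[Num.min/wdot w (mlead f)]_(m <- msupp f) wdot w m.

Definition initial_form w f : {mpoly K[n]} :=
  \sum_(m <- msupp f | wdot w m == weight_order w f) f@_m *: 'X_[m].

Definition initial_ideal w I : set {mpoly K[n]} :=
  ideal_gen [set initial_form w f | f in I `\ 0].

Definition tropical_variety I : set 'cV[R]_n :=
  [set w | forall m : 'X_{1..n}, ~ initial_ideal w I 'X_[m]].

Definition groebner_cone I w : set 'cV[R]_n :=
  closure [set u | initial_ideal u I = initial_ideal w I].

Definition groebner_fan I : set (set 'cV[R]_n) :=
  [set C | exists w (J : {set 'I_n}),
     C = groebner_cone I w `&` subcone 1%:M J].

End InitialIdeals.

Section AffineSpace.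
Variables (K : closedFieldType) (n : nat).
Implicit Types (p q : {mpoly K[n]}) (u v w z : 'cV[K]_n) (A B : 'M[int]_n).

Definition peval p u : K := p.@[fun i => u i 0].

Definition zero_set (S : set {mpoly K[n]}) : set 'cV[K]_n :=
  [set u | forall p, S p -> peval p u = 0].

Definition zariski_closed (Z : set 'cV[K]_n) := exists S, Z = zero_set S.

Definition torus : set 'cV[K]_n := [set z | forall i, z i 0 != 0].

Definition monomial_map A z : 'cV[K]_n :=
  \col_j \prod_i z i 0 ^ A i j.

(* The rational map defined on the torus by f is regular at u, where it takes
   the value v. *)
Definition regular_sends (f : 'cV[K]_n -> 'cV[K]_n) u v :=
  forall j, exists p q,
    [/\ peval q u != 0,
        (forall z, torus z -> peval q z * f z j 0 = peval p z) &
        v j 0 = peval p u / peval q u].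

(* For A in GL(n, Z): the birational map monomial_map A, with inverse
   monomial_map (invmx A), is biregular at u and sends u to v. *)
Definition biregular_sends A u v :=
  regular_sends (monomial_map A) u v /\
  regular_sends (monomial_map (invmx A)) v u.

Lemma torus_monomial_map A z : torus z -> torus (monomial_map A z).
Proof.
move=> tz j; rewrite mxE; apply/prodf_neq0 => i _.
by apply: expfz_neq0.
Qed.

Lemma monomial_map1 z : monomial_map 1%:M z = z.
Proof.
apply/colP => j; rewrite mxE (bigD1 j) //= big1 => [|i /negPf ij].
  by rewrite mxE eqxx expr1z mulr1.
by rewrite mxE ij expr0z.
Qed.

Lemma monomial_mapM A B z : torus z ->
  monomial_map B (monomial_map A z) = monomial_map (A *m B) z.
Proof.
move=> tz; apply/colP => j; rewrite !mxE.
have expz_sum (x : K) (F : 'I_n -> int) : x != 0 ->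
    x ^ (\sum_i F i) = \prod_i x ^ F i.
  move=> x0; apply: (big_morph (fun m : int => x ^ m)) => [a b|].
    exact: expfzDr.
  exact: expr0z.
have expz_prod (m : int) (F : 'I_n -> K) :
    (\prod_i F i) ^ m = \prod_i F i ^ m.
  apply: (big_morph (fun x : K => x ^ m)) => [x y|]; last exact: exp1rz.
  exact: expfzMl.
under eq_bigr => i _ do rewrite mxE expz_prod.
rewrite exchange_big; apply: eq_bigr => k _ /=.
by rewrite mxE expz_sum //; apply: eq_bigr => i _; rewrite exprz_exp.
Qed.

Lemma torus_dense p u : (forall z, torus z -> peval p z = 0) -> peval p u = 0.
Proof.
move=> p0.
pose l i : {poly K} := (u i 0)%:P + (1 - u i 0) *: 'X.
have lE i t : (l i).[t] = u i 0 + (1 - u i 0) * t by rewrite !hornerE.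
pose P := mmap polyC l p.
have PE t : P.[t] = peval p (\col_i (l i).[t]).
  rewrite /P /peval /mmap mevalE horner_sum; apply: eq_bigr => m _.
  rewrite hornerM hornerC; congr (_ * _).
  rewrite /mmap1 horner_prod; apply: eq_bigr => i _.
  by rewrite horner_exp mxE.
suff P0 : P = 0.
  have := PE 0; rewrite P0 horner0 => ->; congr peval.
  by apply/colP => i; rewrite mxE lE mulr0 addr0.
pose L := \prod_i l i.
have L0 : L != 0.
  apply/prodf_neq0 => i _; apply/eqP => /(congr1 (horner^~ 1)).
  by rewrite lE horner0 mulr1 addrC subrK; apply/eqP/oner_neq0.
suff /eqP : L * P = 0 by rewrite mulf_eq0 (negPf L0) => /eqP.
have LP t : (L * P).[t] = 0.
  rewrite hornerM; have [->|Lt] := eqVneq L.[t] 0; first by rewrite mul0r.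
  rewrite PE p0 ?mulr0 // => i; rewrite mxE.
  by move: Lt; rewrite /L horner_prod => /prodf_neq0; apply.
apply/eqP; apply/negPn/negP => LP0.
have [t] := closed_nonrootP _ LP0.
by rewrite /root LP eqxx.
Qed.

Lemma regular_sends_fun f u v v' :
  regular_sends f u v -> regular_sends f u v' -> v = v'.
Proof.
move=> fv fv'; apply/colP => j.
have [p [q [qu fE ->]]] := fv j; have [p' [q' [q'u fE' ->]]] := fv' j.
apply/eqP; rewrite eqr_div // -subr_eq0.
have pevalE x : peval (p * q' - p' * q) x
    = peval p x * peval q' x - peval p' x * peval q x.
  by rewrite /peval mevalB !mevalM.
rewrite -pevalE torus_dense // => z tz.
rewrite pevalE -fE // -fE' // mulrAC -[X in _ - X]mulrA.
by rewrite [X in _ - _ * X]mulrC mulrA [X in _ - X * _]mulrC subrr.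
Qed.

Lemma regular_sends_nneg A u : (forall i j, 0 <= A i j) ->
  regular_sends (monomial_map A) u (monomial_map A u).
Proof.
move=> A0 j; exists (\prod_i 'X_i ^+ absz (A i j)), 1.
have pevalE z : peval (\prod_i 'X_i ^+ absz (A i j)) z = monomial_map A z j 0.
  rewrite mxE /peval rmorph_prod; apply: eq_bigr => i _ /=.
  by rewrite rmorphXn /= mevalXU -[in RHS](gez0_abs (A0 i j)).
have peval1 z : peval 1 z = 1 by rewrite /peval meval1.
split=> [|z _|]; first by rewrite peval1 oner_neq0.
  by rewrite peval1 mul1r pevalE.
by rewrite peval1 divr1 pevalE.
Qed.

Lemma regular_sends1 u : regular_sends (monomial_map 1%:M) u u.
Proof.
rewrite -[X in regular_sends _ u X]monomial_map1; apply: regular_sends_nneg.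
by move=> i j; rewrite mxE; case: (i == j).
Qed.

(* Denominators can be cleared in P(p_1/q_1, ..., p_n/q_n), with exponent d. *)
Lemma peval_frac (p q : 'I_n -> {mpoly K[n]}) (P : {mpoly K[n]}) d :
  (msize P <= d)%N ->
  exists N, forall z, (forall i, peval (q i) z != 0) ->
    peval N z = peval P (\col_i (peval (p i) z / peval (q i) z)) *
                \prod_i peval (q i) z ^+ d.
Proof.
move=> Pd.
exists (\sum_(m <- msupp P) P@_m *: \prod_i (p i ^+ m i * q i ^+ (d - m i))).
move=> z qz; rewrite {2}/peval mevalE mulr_suml /peval (raddf_sum (meval _)) /= big_seq [RHS]big_seq.
apply: eq_bigr => m mP /=; rewrite mevalZ -mulrA; congr (_ * _).
rewrite rmorph_prod -big_split; apply: eq_bigr => i _ /=.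
rewrite rmorphM !rmorphXn /= mxE expr_div_n -mulrA; congr (_ * _).
have mid : (m i <= d)%N.
  apply: leq_trans Pd; apply: leq_trans (ltnW (msize_mdeg_lt mP)).
  by rewrite mdegE (bigD1 i) //= leq_addr.
rewrite -[in RHS](subnK mid) exprD mulrCA.
by rewrite mulVf ?mulr1 // expf_neq0 // qz.
Qed.

Lemma regular_sends_comp A B u v w :
  regular_sends (monomial_map A) u v -> regular_sends (monomial_map B) v w ->
  regular_sends (monomial_map (A *m B)) u w.
Proof.
move=> Auv Bvw j; have [P [Q [Qv BE wE]]] := Bvw j.
have [p /choice[q pq]] := choice Auv.
pose d := maxn (msize P) (msize Q).
have [NP NPE] := @peval_frac p q P d (leq_maxl _ _).
have [NQ NQE] := @peval_frac p q Q d (leq_maxr _ _).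
pose D := \prod_i q i; exists (NP * D), (NQ * D).
have DE z : peval D z = \prod_i peval (q i) z by rewrite /peval rmorph_prod.
have pevalDM N z : peval (N * D) z = peval N z * peval D z.
  by rewrite /peval mevalM.
have qu i : peval (q i) u != 0 by have [] := pq i.
have vE : v = \col_i (peval (p i) u / peval (q i) u).
  by apply/colP => i; rewrite mxE; have [] := pq i.
have Du : \prod_i peval (q i) u ^+ d != 0.
  by apply/prodf_neq0 => i _; apply: expf_neq0.
have Du1 : peval D u != 0 by rewrite DE; apply/prodf_neq0 => i _.
split.
- by rewrite pevalDM NQE // -vE !mulf_neq0.
- move=> z tz; rewrite !pevalDM.
  have [->|Dz] := eqVneq (peval D z) 0; first by rewrite !mulr0 mul0r.
  have qz i : peval (q i) z != 0 by move: Dz; rewrite DE => /prodf_neq0; apply.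
  have yE : monomial_map A z = \col_i (peval (p i) z / peval (q i) z).
    apply/colP => i; rewrite [RHS]mxE; have [_ /(_ z tz) <- _] := pq i.
    by rewrite mulrAC mulfV ?mul1r.
  rewrite NPE // NQE // -yE -monomial_mapM // -BE; last exact: torus_monomial_map.
  by rewrite mulrAC; congr (_ * _); rewrite mulrAC.
- rewrite !pevalDM NPE // NQE // -vE wE -mulf_div mulfV // mulr1 -mulf_div.
  by rewrite mulfV // mulr1.
Qed.

Lemma biregular_sends_comp A B u v w : A \in unitmx -> B \in unitmx ->
  biregular_sends A u v -> biregular_sends B v w ->
  biregular_sends (A *m B) u w.
Proof.
move=> uA uB [Auv Avu] [Bvw Bwv]; split; first exact: regular_sends_comp Bvw.
suff -> : invmx (A *m B) = invmx B *m invmx A by exact: regular_sends_comp Avu.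
apply: (can_inj (mulKmx (_ : A *m B \in unitmx))); first by rewrite unitmx_mul uA.
by rewrite mulmxV ?unitmx_mul ?uA // mulmxA mulmxK // mulmxV.
Qed.

End AffineSpace.

Section ToricModification.
Variables (R : realType) (K : closedFieldType) (n : nat).
Variable Sigma : set (set 'cV[R]_n).

(* A chart is a matrix M in GL(n, Z) with Cone(M) in Sigma: the same cone
   gives one chart for each ordering of its rays, and these charts are glued
   together by permutation of the coordinates. *)
Definition is_chart (M : 'M[int]_n) : bool :=
  (M \in unitmx) && `[< Sigma (cone (realmx R M)) >].

Definition chart := {M : 'M[int]_n | is_chart M}.

Lemma chart_unit (M : chart) : val M \in unitmx.
Proof. by case/andP: (valP M). Qed.

(* The disjoint union of the U_sigma. *)
Definition chart_point := (chart * 'cV[K]_n)%type.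

Definition transition_mx (M M' : chart) : 'M[int]_n :=
  (val M)^T *m (invmx (val M'))^T.

Lemma transition_mx_unit M M' : transition_mx M M' \in unitmx.
Proof. by rewrite unitmx_mul !unitmx_tr unitmx_inv !chart_unit. Qed.

Lemma transition_mx_inv M M' : invmx (transition_mx M M') = transition_mx M' M.
Proof.
apply: (can_inj (mulKmx (transition_mx_unit M M'))).
rewrite mulmxV ?transition_mx_unit // /transition_mx -!trmx_mul.
by rewrite mulmxA mulmxK ?chart_unit // mulVmx ?chart_unit // trmx1.
Qed.

Definition glue (x y : chart_point) : bool :=
  `[< biregular_sends (transition_mx x.1 y.1) x.2 y.2 >].

Lemma glue_refl : reflexive glue.
Proof.
move=> [M u]; apply/asboolP; rewrite /biregular_sends transition_mx_inv /=.
suff -> : transition_mx M M = 1%:M by split; exact: regular_sends1.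
by rewrite /transition_mx -trmx_mul mulVmx ?chart_unit // trmx1.
Qed.

Lemma glue_sym : ssrbool.symmetric glue.
Proof.
suff imp x y : glue x y -> glue y x by move=> x y; apply/idP/idP; exact: imp.
move=> /asboolP [xy yx]; apply/asboolP; rewrite transition_mx_inv in yx.
by split=> //; rewrite transition_mx_inv.
Qed.

Lemma glue_trans : transitive glue.
Proof.
move=> y x z /asboolP xy /asboolP yz; apply/asboolP.
suff -> : transition_mx x.1 z.1
    = transition_mx x.1 y.1 *m transition_mx y.1 z.1.
  by apply: biregular_sends_comp xy yz; exact: transition_mx_unit.
rewrite /transition_mx mulmxA -[in RHS](mulmxA (val x.1)^T) -[in RHS]trmx_mul.
by rewrite mulmxV ?chart_unit // trmx1 mulmx1.
Qed.

Definition glue_equiv := EquivRel glue glue_refl glue_sym glue_trans.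
Canonical glue_equiv.

Definition toric_variety := {eq_quot glue_equiv}.

Definition chart_incl (M : chart) (u : 'cV[K]_n) : toric_variety :=
  \pi_toric_variety (M, u).

Definition toric_modification (x : toric_variety) : 'cV[K]_n :=
  monomial_map (val (repr x).1)^T (repr x).2.

Lemma toric_modificationE : fan_support Sigma = orthant R n ->
  forall M u, toric_modification (chart_incl M u) = monomial_map (val M)^T u.
Proof.
move=> suppS M u; rewrite /toric_modification /chart_incl.
set y := repr _; have My : glue (M, u) y.
  by rewrite -[glue _ _]/(glue_equiv _ _) -eqmodE reprK.
have nnegT (N : chart) i j : 0 <= (val N)^T i j.
  rewrite mxE; have /andP[_ /asboolP SN] := valP N.
  have : orthant R n (col i (realmx R (val N))).
    rewrite -suppS; exists (cone (realmx R (val N))) => //.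
    exists (delta_mx i 0); last by rewrite colE.
    by move=> k /=; rewrite mxE; case: (_ && _).
  by move=> /(_ j); rewrite !mxE ler0z.
move/asboolP: My => [My _] /=.
apply: (@regular_sends_fun _ _ (monomial_map (val M)^T) u); last first.
  exact: regular_sends_nneg.
suff -> : (val M)^T = transition_mx M y.1 *m (val y.1)^T.
  by apply: regular_sends_comp My _; apply: regular_sends_nneg.
by rewrite /transition_mx -mulmxA -trmx_mul mulmxV ?chart_unit // trmx1 mulmx1.
Qed.

Definition toric_closed (Z : set toric_variety) :=
  forall M : chart, zariski_closed (chart_incl M @^-1` Z).

Definition toric_closure (Z : set toric_variety) : set toric_variety :=
  smallest toric_closed Z.

(* O(tau), for a face tau of an n-dimensional cone of Sigma. *)
Definition toric_orbit (tau : set 'cV[R]_n) : set toric_variety :=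
  [set x | exists (M : chart) (J : {set 'I_n}) (u : 'cV[K]_n),
    [/\ tau = subcone (realmx R (val M)) J,
        (forall i, u i 0 = 0 <-> i \in J) & x = chart_incl M u]].

Definition strict_transform (V : set 'cV[K]_n) : set toric_variety :=
  toric_closure (toric_modification @^-1`
    (V `\` zero_set [set \prod_(i < n) 'X_i])).

End ToricModification.

Arguments tropical_variety R {K n} I.
Arguments groebner_fan R {K n} I.
Arguments toric_orbit {R} K {n} Sigma tau.
Arguments strict_transform {R K n} Sigma V.

(* Main.v *)
(* Let tau be the face of a chart cone Cone(M) spanned by the columns with index
   in J. Since Sigma refines the Groebner fan and TV(I) is closed, TV(I) contains
   tau as soon as it contains one point of the relative interior of tau.

   If w is the sum of the generators of tau and the closure of the torus part of
   V(I) misses O(tau) in the chart, the Nullstellensatz gives an element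
   s = y^k + (terms divisible by some y_i, i in J), with k_i = 0 on J, vanishing
   on that torus part; a power of s times a monomial comes from an element of I
   whose w-initial form is a monomial, so w is not in TV(I).

   Conversely, a point of O(tau) in the strict transform prevents I from containing
   a Laurent multiple of an element 1 + (terms in the ideal of the y_i, i in J).
   By Zorn's lemma and Chevalley's argument for valuation rings, applied to
   exponents only, there is a total preorder on Z^n, positive on the y_i with i in
   J and trivial on the other y_i, for which no element of I has a monomial as its
   initial form. A degree-wise standard basis of I for this preorder is finitely
   generated by Dickson's lemma, and involves finitely many strict comparisons,
   which Gordan's theorem realizes by a real weight w in the relative interior of
   tau. An element of I with w-initial form a monomial could be reduced by this
   basis to one with the same property for the preorder; hence w is in TV(I). *)
Require Import Defs.
From HB Require Import structures.
From mathcomp Require Import all_boot all_order all_algebra.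
From mathcomp Require Import boolp classical_sets cardinality reals topology.
From mathcomp Require Import mpoly.
From mathcomp Require Import ring lra zify.
Set Implicit Arguments.
Unset Strict Implicit.
Unset Printing Implicit Defensive.
Import Order.TTheory GRing.Theory Num.Theory.
Import numFieldTopology.Exports.
Local Open Scope ring_scope.
Local Open Scope classical_set_scope.

(** * Gordan's theorem over an ordered field *)

(** The columns of [cokermx U^T] cut out the column space of [U]; one that does not kill [b],
    rescaled, is [e]. *)
Lemma not_submx_functional (F : fieldType) n l (U : 'M[F]_(n, l)) (b : 'cV[F]_n) :
  (exists d, b = U *m d) \/ exists2 e : 'rV_n, e *m U = 0 & (e *m b) 0 0 = 1.
Proof.
have [/submxP[D bD]|] := boolP (b^T <= U^T)%MS.
  by left; exists D^T; apply: trmx_inj; rewrite bD trmx_mul trmxK.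
rewrite submxE => /eqP nz; right.
have [j bj] : exists j, (b^T *m cokermx U^T) 0 j != 0.
  apply/existsP; apply: contra_notT nz => /existsPn bj0.
  by apply/rowP => j; rewrite [RHS]mxE; apply/eqP/negPn/bj0.
pose e := (col j (cokermx U^T))^T.
have eb : (e *m b) 0 0 = (b^T *m cokermx U^T) 0 j.
  by rewrite -[e *m b]trmxK trmx_mul trmxK mxE colE mulmxA -colE mxE.
exists (((e *m b) 0 0)^-1 *: e).
  rewrite -scalemxAl -[e *m U]trmxK trmx_mul trmxK colE mulmxA mulmx_coker.
  by rewrite mul0mx trmx0 scaler0.
by rewrite -scalemxAl mxE mulVf // eb.
Qed.

Lemma small_pos (F : realFieldType) k (p q : 'I_k -> F) :
  (forall i, 0 < p i) -> exists2 e, 0 < e & forall i, 0 < p i + e * q i.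
Proof.
(* The [+ 1] avoids a zero denominator and leaves the slack that makes the inequality strict. *)
move=> p0; pose e := \big[Num.min/1]_i (p i / (`|q i| + 1)).
have e0 : 0 < e.
  rewrite /e; elim/big_ind: _ => // [x y x0 y0|i _]; first by rewrite lt_min x0.
  by rewrite divr_gt0 // ltr_wpDl.
exists e => // i.
have ei : e * (`|q i| + 1) <= p i.
  rewrite -ler_pdivlMr ?ltr_wpDl //.
  by rewrite /e; apply: bigmin_le_cond.
have : - (e * q i) <= e * `|q i| by rewrite -mulrN ler_pM2l // ler_normr lexx orbT.
by move: ei e0; rewrite mulrDr mulr1; lra.
Qed.

(** Induction on the columns of [B]. If the functional [w] found for [B'] is not positive on the
    first column [b], the induction hypothesis is used again with [b] adjoined to [U]; a functional
    killing [b] as well is then perturbed by one equal to 1 on [b]. *)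
Lemma gordan (F : realFieldType) n k l (U : 'M[F]_(n, l)) (B : 'M[F]_(n, k)) :
  (exists2 w : 'rV_n, w *m U = 0 & forall j, 0 < (w *m B) 0 j) \/
  (exists c : 'cV_k, [/\ forall j, 0 <= c j 0, c != 0 &
     exists d, B *m c = U *m d]).
Proof.
elim: k l U B => [|k IH] l U B.
  by left; exists 0 => [|[]//]; rewrite mul0mx.
pose b : 'cV_n := @lsubmx F n 1 k B; pose B' : 'M_(n, k) := @rsubmx F n 1 k B.
have BE : B = row_mx b B' :> 'M_(n, 1 + k) by rewrite hsubmxK.
have Bc t (c : 'cV_k) : B *m (col_mx t c : 'cV_(1 + k)) = b *m t + B' *m c.
  by rewrite -[LHS]/(@mulmx F n (1 + k) 1 B (col_mx t c)) BE mul_row_col.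
have c_ge0 (t : 'cV_1) (c : 'cV_k) : 0 <= t 0 0 -> (forall j, 0 <= c j 0) ->
    forall j, 0 <= (col_mx t c : 'cV_(1 + k)) j 0.
  by move=> t0 c0 j; rewrite mxE; case: split => i //; rewrite ord1.
have c_neq0 (t : 'cV_1) (c : 'cV_k) : (t != 0) || (c != 0) ->
    (col_mx t c : 'cV_(1 + k)) != 0.
  by rewrite col_mx_eq0 negb_and.
have wB_gt0 (w : 'rV_n) : 0 < (w *m b) 0 0 -> (forall j, 0 < (w *m B') 0 j) ->
    forall j, 0 < (w *m B) 0 j.
  move=> wb wB' j; rewrite -[w *m B]/(@mulmx F 1 n (1 + k) w B) BE mul_mx_row mxE; case: split => i //.
  by rewrite ord1.
have [[w wU wB]|[c [c0 cn0 [d Bd]]]] := IH l U B'; last first.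
  right; exists (col_mx 0 c : 'cV_(1 + k)); split.
  - by apply: c_ge0 => //; rewrite mxE.
  - by rewrite c_neq0 // cn0 orbT.
  - by exists d; rewrite Bc mulmx0 add0r.
have [wb|wb] := ltP 0 ((w *m b) 0 0); first by left; exists w => //; exact: wB_gt0.
have [[v vU vB]|[c [c0 cn0 [d]]]] := IH _ (row_mx U b) B'; last first.
  rewrite -[d]vsubmxK mul_row_col; move: (usubmx d) (dsubmx d) => {}d t Bt.
  have wBc : 0 < (w *m (B' *m c)) 0 0.
    rewrite mulmxA mxE; have [j cj] : exists j, c j 0 != 0.
      apply/existsP; apply: contraNT cn0 => /existsPn cj0.
      by apply/eqP/colP => j; rewrite [RHS]mxE; apply/eqP/negPn/cj0.
    rewrite (bigD1 j) //= ltr_wpDr //.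
      by apply: sumr_ge0 => i _; rewrite mulr_ge0 // ltW.
    by rewrite mulr_gt0 // lt_def cj c0.
  (* Applying [w] to the relation gives [0 < (w b) t] with [w b <= 0], so [b] moves to the other
     side with a positive coefficient. *)
  have t0 : t 0 0 < 0.
    move: wBc; rewrite Bt mulmxDr mulmxA wU mul0mx add0r mulmxA mxE big_ord1.
    by move=> wbt; have := mulr_le0_ge0 wb; rewrite ltNge => wbt'; apply/negP => /wbt'; rewrite leNgt wbt.
  right; exists (col_mx (- t) c : 'cV_(1 + k)); split.
  - by apply: c_ge0 => //; rewrite mxE oppr_ge0 ltW.
  - by rewrite c_neq0 // cn0 orbT.
  - by exists d; rewrite Bc Bt addrCA mulmxN addNr addr0.
move: vU; rewrite mul_mx_row -[0]hsubmxK => /eq_row_mx[].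
rewrite linear0 => vU; rewrite linear0 => vb.
have [[d bd]|[e eU eb]] := not_submx_functional U b.
  right; exists (col_mx 1%:M 0 : 'cV_(1 + k)); split.
  - by apply: c_ge0 => [|j]; rewrite mxE.
  - by rewrite c_neq0 // oner_neq0.
  - by exists d; rewrite Bc mulmx0 addr0 mulmx1.
have [x x0 xP] := small_pos (fun j => (e *m B') 0 j) vB.
left; exists (v + x *: e).
  by rewrite mulmxDl vU add0r -scalemxAl eU scaler0.
apply: wB_gt0 => [|j]; rewrite mulmxDl -scalemxAl.
  by rewrite vb add0r mxE eb mulr1.
by rewrite !mxE; have := xP j; rewrite !mxE.
Qed.

(** * Cones spanned by columns, and their rays *)

Section Cones.
Variables (R : realType) (n : nat).
Implicit Types (C D : set 'cV[R]_n).

Lemma colsub_enum_mul k (A : 'M[R]_(n, k)) (J : {set 'I_k}) (c : 'cV[R]_#|J|) :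
  exists c' : 'cV_k, [/\ forall j, c' (enum_val j) 0 = c j 0,
    forall i, i \notin J -> c' i 0 = 0 &
    colsub (fun i : 'I_#|J| => enum_val i) A *m c = A *m c'].
Proof.
exists (colsub (fun i : 'I_#|J| => enum_val i) 1%:M *m c); split.
- move=> j; rewrite mxE (bigD1 j) //= big1 ?addr0.
    by rewrite !mxE eqxx mul1r.
  by move=> i ij; rewrite !mxE (inj_eq enum_val_inj) eq_sym (negPf ij) mul0r.
- move=> i iJ; rewrite mxE big1 // => j _; rewrite !mxE.
  case: eqP => [ij|]; last by rewrite mul0r.
  by rewrite ij enum_valP in iJ.
- by rewrite mulmxA mulmx_colsub mulmx1.
Qed.

Lemma subconeP k (A : 'M[R]_(n, k)) (J : {set 'I_k}) u :
  subcone A J u <-> exists c : 'cV[R]_k,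
    [/\ forall i, 0 <= c i 0, forall i, i \notin J -> c i 0 = 0 & u = A *m c].
Proof.
split=> [[c c0 <-]|[c [c0 cJ ->]]].
  have [c' [c'E c'J ->]] := colsub_enum_mul A c; exists c'; split=> // i.
  have [iJ|/c'J ->//] := boolP (i \in J).
  by rewrite -(enum_rankK_in iJ iJ) c'E.
exists (\col_i c (enum_val i) 0); first by move=> i /=; rewrite mxE.
apply/colP => i; rewrite !mxE [RHS](bigID (fun j => j \in J)) /=.
rewrite [X in _ = _ + X]big1 ?addr0 => [|j /cJ ->]; last by rewrite mulr0.
by rewrite [RHS]big_enum_val; apply: eq_bigr => j _; rewrite !mxE.
Qed.

Lemma cone_col k (A : 'M[R]_(n, k)) j : cone A (col j A).
Proof.
exists (delta_mx j 0); last by rewrite colE.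
by move=> i; rewrite mxE ler0n.
Qed.

Lemma subcone_subset k (A : 'M[R]_(n, k)) J : subcone A J `<=` cone A.
Proof. by move=> u /subconeP[c [c0 _ ->]]; exists c. Qed.

Lemma subconeT k (A : 'M[R]_(n, k)) : subcone A [set: 'I_k]%SET = cone A.
Proof.
apply/seteqP; split; first exact: subcone_subset.
by move=> u [c c0 <-]; apply/subconeP; exists c; split=> // i; rewrite inE.
Qed.

Lemma subcone1T : subcone 1%:M [set: 'I_n]%SET = orthant R n.
Proof.
rewrite subconeT; apply/seteqP; split=> u; first by move=> [c c0 <-]; rewrite mul1mx.
by move=> u0; exists u; rewrite // mul1mx.
Qed.

Lemma dotv_mul (w : 'rV[R]_n) k (A : 'M[R]_(n, k)) (c : 'cV_k) :
  dotv w^T (A *m c) = \sum_i (w *m A) 0 i * c i 0.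
Proof.
transitivity ((w *m A *m c) 0 0); last by rewrite mxE.
by rewrite -mulmxA mxE; apply: eq_bigr => i _; rewrite mxE.
Qed.

Lemma dotv_col (w : 'rV[R]_n) k (A : 'M[R]_(n, k)) j :
  dotv w^T (col j A) = (w *m A) 0 j.
Proof. by rewrite mxE; apply: eq_bigr => i _; rewrite !mxE. Qed.

Lemma subcone_dropl k (A : 'M[R]_(n, k)) J j (c0 : 'cV_k) :
  (forall i, 0 <= c0 i 0) -> (forall i, i \notin J :\ j -> c0 i 0 = 0) ->
  col j A = A *m c0 -> subcone A J = subcone A (J :\ j).
Proof.
move=> c0_ge0 c0J Aj; apply/seteqP; split=> u /subconeP[c [c_ge0 cJ ->]].
  apply/subconeP; exists (c - c j 0 *: delta_mx j 0 + c j 0 *: c0); split.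
  - move=> i; rewrite !mxE addr_ge0 ?mulr_ge0 // eqxx andbT.
    by case: eqP => [->|]; rewrite ?mulr1 ?subrr // mulr0 subr0.
  - move=> i iJ; rewrite !mxE eqxx andbT (c0J _ iJ) mulr0 addr0.
    case: eqP => [->|/eqP ij]; first by rewrite mulr1 subrr.
    by rewrite mulr0 subr0 cJ //; move: iJ; rewrite !inE ij.
  - rewrite mulmxDr mulmxBr -!scalemxAr -Aj colE.
    by rewrite subrK.
apply/subconeP; exists c; split=> // i iJ; apply: cJ.
by apply: contra iJ; rewrite !inE => /andP[].
Qed.

Lemma primitive_multiple (v : 'cV[int]_n) : v != 0 ->
  exists g (v' : 'cV[int]_n), [/\ (0 < g)%N, primitive_vec v' & v = g%:Z *: v'].
Proof.
move=> v0; pose g := (\big[gcdn/0]_(i < n) absz (v i ord0))%N.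
have gv i : (g %| absz (v i ord0))%N.
  by rewrite /g (bigD1 i) //= dvdn_gcdl.
have g0 : (0 < g)%N.
  rewrite lt0n; apply: contraNneq v0 => g0; apply/eqP/colP => i.
  by have := gv i; rewrite g0 dvd0n absz_eq0 mxE => /eqP.
have vE : v = g%:Z *: (\col_i ((v i ord0) %/ g%:Z)%Z).
  apply/colP => i; rewrite !mxE mulrC divzK //.
  by rewrite dvdzE /= gv.
exists g, (\col_i ((v i ord0) %/ g%:Z)%Z); split=> //.
apply/eqP; rewrite -(eqn_pmul2l g0) muln1; apply/eqP.
rewrite (big_morph (fun x => g * x)%N (id1 := 0%N) (op1 := gcdn)).
- by apply: eq_bigr => i _; rewrite [in RHS]vE [in RHS]mxE abszM.
- by move=> x y; rewrite muln_gcdr.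
- by rewrite muln0.
Qed.

(** Take a minimal set [J] of columns spanning the cone. By minimality and strong convexity,
    Gordan's theorem gives for each [j] in [J] a functional that kills column [j] and is positive on
    the other columns in [J]; column [j] thus spans a ray, whose primitive generator is a column of
    [P]. *)
Lemma sub_cone_rays k (A : 'M[int]_(n, k)) l (P : 'M[int]_(n, l)) :
  strongly_convex (cone (Defs.realmx R A)) ->
  (forall v, primitive_ray_generator (cone (Defs.realmx R A)) v -> exists j, v = col j P) ->
  cone (Defs.realmx R A) `<=` cone (Defs.realmx R P).
Proof.
move=> sc rays; set B := Defs.realmx R A.
pose Q (J : {set 'I_k}) := `[< cone B = subcone B J >].
have QT : Q [set: 'I_k]%SET by apply/asboolP; rewrite subconeT.
have [J /asboolP BJ minJ] := arg_minnP (fun J : {set 'I_k} => #|J|) QT.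
have noDrop j (c0 : 'cV[R]_k) : j \in J -> (forall i, 0 <= c0 i 0) ->
    (forall i, i \notin J :\ j -> c0 i 0 = 0) -> col j B = B *m c0 -> False.
  move=> jJ c0_ge0 c0J Bj; have := minJ (J :\ j).
  rewrite /Q -(subcone_dropl c0_ge0 c0J Bj) -BJ => /(_ (asboolT erefl)).
  by rewrite (cardsD1 j J) jJ add1n ltnn.
have colP' j : j \in J -> cone (Defs.realmx R P) (col j B).
  move=> jJ.
  have Aj0 : col j A != 0.
    apply/eqP => Aj0; apply: (noDrop j 0) => // [i|i _|]; rewrite ?mxE //.
    rewrite mulmx0 /B /Defs.realmx -map_col Aj0; apply/colP => i.
    by rewrite !mxE.
  have [g [v [g0 pv vE]]] := primitive_multiple Aj0.
  have BvE : col j B = g%:R *: Defs.realmx R v.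
    by rewrite /B /Defs.realmx -map_col vE; apply/colP => i; rewrite !mxE intrM.
  have coneE : cone (Defs.realmx R v) = [set u | exists2 t, 0 <= t & u = t *: col j B].
    have gR : 0 < g%:R :> R by rewrite ltr0n.
    apply/seteqP; split=> u.
      move=> [c c0 <-]; exists (c 0 0 / g%:R).
        by rewrite divr_ge0 // ltW.
      rewrite BvE scalerA divfK ?gt_eqF // [c in LHS]mx11_scalar mul_mx_scalar //.
    move=> [t t0 ->]; exists (t * g%:R)%:M.
      by move=> i /=; rewrite ord1 mxE eqxx mulr_ge0 // ltW.
    by rewrite mul_mx_scalar BvE scalerA.
  suff [l' vl] : exists j, v = col j P.
    rewrite BvE vl; exists (g%:R *: delta_mx l' 0).
      by move=> i /=; rewrite !mxE mulr_ge0 // ler0n.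
    by rewrite -scalemxAr -colE /Defs.realmx map_col.
  apply: rays; split=> //; rewrite coneE.
  have [[w wU wB]|[c [c0 cn0 [d cd]]]] :=
    gordan (col j B) (colsub (fun i : 'I_#|J :\ j| => enum_val i) B).
    have wBi i : i \in J -> i != j -> 0 < (w *m B) 0 i.
      move=> iJ ij; have iJj : i \in J :\ j by rewrite !inE ij.
      have := wB (enum_rank_in iJj i).
      by rewrite mulmx_colsub mxE enum_rankK_in.
    have wBj : (w *m B) 0 j = 0.
      by move/matrixP: wU => /(_ 0 0); rewrite colE mulmxA -colE !mxE.
    exists w^T => [u|]; rewrite BJ.
      move=> /subconeP[c [c_ge0 cJ ->]]; rewrite dotv_mul; apply: sumr_ge0 => i _.
      have [->|ij] := eqVneq i j; first by rewrite wBj mul0r.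
      have [iJ|/cJ ->] := boolP (i \in J); last by rewrite mulr0.
      by rewrite mulr_ge0 // ltW // wBi.
    apply/seteqP; split=> u.
      move=> [t t0 ->]; split.
        apply/subconeP; exists (t *: delta_mx j 0); split.
        - by move=> i; rewrite !mxE mulr_ge0 // ler0n.
        - move=> i iJ; rewrite !mxE eqxx andbT; case: eqP => [ij|]; last by rewrite mulr0.
          by rewrite ij jJ in iJ.
        - by rewrite -scalemxAr colE.
      rewrite /= colE scalemxAr dotv_mul big1 // => i _; rewrite !mxE eqxx andbT.
      case: eqP => [->|]; last by rewrite !mulr0.
      by move: wBj; rewrite mxE => ->; rewrite mul0r.
    move=> [/subconeP[c [c_ge0 cJ ->]]]; rewrite /= dotv_mul => /eqP.
    rewrite psumr_eq0 => [/allP c0|i _]; last first.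
      have [->|ij] := eqVneq i j; first by rewrite wBj mul0r.
      have [iJ|/cJ ->] := boolP (i \in J); last by rewrite mulr0.
      by rewrite mulr_ge0 // ltW // wBi.
    exists (c j 0) => //; rewrite colE scalemxAr; congr (_ *m _); apply/colP => i.
    rewrite !mxE eqxx andbT; have [->|ij] := eqVneq i j; first by rewrite mulr1.
    rewrite mulr0; have [iJ|/cJ //] := boolP (i \in J).
    have := c0 i; rewrite mem_index_enum mulf_eq0 gt_eqF ?wBi //= => /(_ isT).
    by move/eqP.
  (* A relation [B c' = d b_j] contradicts minimality: if [d > 0], column [j] is redundant;
     otherwise a multiple of column [i0] and its opposite both lie in the cone, so column [i0] is
     zero. *)
  exfalso; have [c' [c'E c'J]] := colsub_enum_mul B c.
  rewrite cd [d]mx11_scalar mul_mx_scalar; move: (d 0 0) => {cd} {}d Bc'.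
  have [i0 i0J c'i0] : exists2 i, i \in J :\ j & 0 < c' i 0.
    have [l' cl'] : exists l', c l' 0 != 0.
      apply/existsP; apply: contraNT cn0 => /existsPn cj0.
      by apply/eqP/colP => i; rewrite [RHS]mxE; apply/eqP/negPn/cj0.
    by exists (enum_val l'); rewrite ?enum_valP // c'E lt_def cl' c0.
  have c'_ge0 i : 0 <= c' i 0.
    have [iJ|/c'J ->//] := boolP (i \in J :\ j).
    by rewrite -(enum_rankK_in iJ iJ) c'E.
  move: i0J; rewrite !inE => /andP[i0j i0J].
  have [d0|d0] := ltP 0 d.
    apply: (noDrop j (d^-1 *: c')) => // [i|i iJ|].
    - by rewrite mxE mulr_ge0 // invr_ge0 ltW.
    - by rewrite mxE c'J // mulr0.
    - by rewrite -scalemxAr -Bc' scalerA mulVf ?scale1r // gt_eqF.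
  have Bi0 : c' i0 0 *: col i0 B = 0.
    apply: sc; rewrite -/B.
      exists (c' i0 0 *: delta_mx i0 0); last by rewrite -scalemxAr colE.
      by move=> i /=; rewrite !mxE mulr_ge0 // ler0n.
    exists (c' - c' i0 0 *: delta_mx i0 0 - d *: delta_mx j 0); last first.
      by rewrite !mulmxBr -!scalemxAr -Bc' -!colE addrAC subrr sub0r.
    move=> i /=; rewrite !mxE !eqxx !andbT; have [->|ii0] := eqVneq i i0.
      by rewrite (negPf i0j) mulr0 mulr1 subrr subr0.
    by rewrite mulr0 subr0 subr_ge0 (le_trans _ (c'_ge0 _)) // mulr_le0_ge0 // ler0n.
  apply: (noDrop i0 0) => // [i|i _|]; rewrite ?mxE //.
  by rewrite mulmx0; move/eqP: Bi0; rewrite scaler_eq0 gt_eqF //= => /eqP.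
move=> u; rewrite BJ => /subconeP[c [c_ge0 cJ ->]].
have [T QE] : exists T : 'I_k -> 'cV[R]_l, forall j,
    (forall i, 0 <= T j i 0) /\ c j 0 *: col j B = Defs.realmx R P *m T j.
  have QE j : exists q : 'cV[R]_l,
    (forall i, 0 <= q i 0) /\ c j 0 *: col j B = Defs.realmx R P *m q.
    have [/colP'[q q0 <-]|/cJ ->] := boolP (j \in J); last first.
      by exists 0; split=> [i|]; rewrite ?mxE // scale0r mulmx0.
    exists (c j 0 *: q); split=> [i|]; last by rewrite scalemxAr.
    by rewrite mxE mulr_ge0.
  by have [T] := choice QE; exists T.
exists (\sum_j T j).
  by move=> i /=; rewrite summxE; apply: sumr_ge0 => j _; have [] := QE j.
rewrite mulmx_sumr; under eq_bigr => j _ do rewrite -(QE j).2.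
by apply/colP => i; rewrite summxE mxE; apply: eq_bigr => j _; rewrite !mxE mulrC.
Qed.
End Cones.

(** * Unimodular cones of the fan and charts containing a given cone *)

(** The coordinates of the standard basis form a right inverse of [P]; uniqueness of coordinates
    makes it a left inverse too, and the two together force [k = n]. *)
Lemma basis_unitmx n k (P : 'M[int]_(n, k)) :
  (forall w : 'cV_n, exists! c : 'cV_k, w = P *m c) ->
  exists e : k = n, castmx (erefl n, e) P \in unitmx.
Proof.
move=> Pb; have Pdelta (j : 'I_n) : exists q : 'cV_k, delta_mx j 0 = P *m q.
  by have [c []] := Pb (delta_mx j 0); exists c.
have [Q QE] := choice Pdelta.
pose N := \matrix_(i, j) Q j i 0.
have colN j : col j N = Q j by apply/colP => i; rewrite !mxE.
have eq_col_mx m p (A B : 'M[int]_(m, p)) : (forall j, col j A = col j B) -> A = B.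
  by move=> AB; apply/matrixP => i j; have /colP/(_ i) := AB j; rewrite !mxE.
have PN : P *m N = 1%:M.
  by apply: eq_col_mx => j; rewrite !colE -mulmxA -colE colN mul1mx -QE.
have NP : N *m P = 1%:M.
  apply: eq_col_mx => j; have [c [_ cU]] := Pb (P *m (delta_mx j 0 : 'cV_k)).
  rewrite !colE mul1mx; transitivity c; last exact: cU.
  apply/esym/cU.
  by rewrite -mulmxA (mulmxA P) PN mul1mx.
have e : k = n by apply/eqP; rewrite eqn_leq (mulmx1_min PN) (mulmx1_min NP).
exists e; clear -PN; subst k.
by rewrite castmx_id; case: (mulmx1_unit PN).
Qed.

Section PolySmall.
Variable R : realFieldType.
Implicit Types q : {poly R}.

Lemma poly_lt0_near q : q.[0] < 0 ->
  exists2 d, 0 < d & forall e, 0 < e < d -> q.[e] < 0.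
Proof.
move=> q0; have /factor_theorem[r rE] : root (q - q.[0]%:P) 0.
  by rewrite /root !hornerE subrr.
have qE x : q.[x] = q.[0] + r.[x] * x.
  have := congr1 (horner^~ x) rE; rewrite !hornerE => /eqP.
  by rewrite subr_eq addrC subr0 => /eqP.
pose C := \sum_(i < size r) `|r`_i| + 1.
have C0 : 0 < C by rewrite ltr_wpDl // sumr_ge0.
exists (Num.min 1 (- q.[0] / C)); first by rewrite lt_min ltr01 divr_gt0 // oppr_gt0.
move=> e /andP[e0]; rewrite lt_min => /andP[e1]; rewrite ltr_pdivlMr // => eC.
have rC : r.[e] <= C.
  rewrite horner_coef /C ler_wpDr //; apply: ler_sum => i _.
  apply: le_trans (ler_norm _) _; rewrite normrM ler_piMr //.
  by rewrite ger0_norm ?exprn_ge0 ?exprn_ile1 // ltW.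
rewrite qE; have : r.[e] * e <= C * e by rewrite ler_pM2r.
by move: eC; rewrite mulrC; lra.
Qed.

(** Dividing by the power of [X] in [q] leaves a nonzero constant term, whose sign persists near
    0. *)
Lemma poly_neq0_near q : q != 0 ->
  exists2 d, 0 < d & forall e, 0 < e < d -> q.[e] != 0.
Proof.
have neg (p : {poly R}) : p.[0] != 0 -> exists2 d, 0 < d & forall e, 0 < e < d -> p.[e] != 0.
  case: (ltgtP p.[0] 0) => // p0 _.
    by have [d d0 dP] := poly_lt0_near p0; exists d => // e /dP; rewrite lt_neqAle => /andP[].
  have [|d d0 dP] := @poly_lt0_near (- p); first by rewrite hornerN oppr_lt0.
  by exists d => // e /dP; rewrite hornerN oppr_lt0 lt_neqAle eq_sym => /andP[].
move=> q0; have [m [p]] := multiplicity_XsubC q 0; rewrite q0 /= => /neg[d d0 dP] ->.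
exists d => // e /[dup] /dP pe /andP[e0 _].
by rewrite !hornerE mulf_neq0 // expf_neq0 // subr0 gt_eqF.
Qed.
End PolySmall.

Section FullCones.
Variables (R : realType) (n : nat).
Implicit Types (C D : set 'cV[R]_n) (Sigma : set (set 'cV[R]_n)).

Lemma realmxM m k l (A : 'M[int]_(m, k)) (B : 'M[int]_(k, l)) :
  Defs.realmx R (A *m B) = Defs.realmx R A *m Defs.realmx R B.
Proof. exact: map_mxM. Qed.

Lemma realmx1 m : Defs.realmx R (1%:M : 'M[int]_m) = 1%:M.
Proof. exact: map_mx1. Qed.

Lemma realmxKV (M : 'M[int]_n) : M \in unitmx ->
  Defs.realmx R M *m Defs.realmx R (invmx M) = 1%:M.
Proof. by move=> uM; rewrite -realmxM mulmxV // realmx1. Qed.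

Lemma realmxVK (M : 'M[int]_n) : M \in unitmx ->
  Defs.realmx R (invmx M) *m Defs.realmx R M = 1%:M.
Proof. by move=> uM; rewrite -realmxM mulVmx // realmx1. Qed.

Lemma cone_unitP (M : 'M[int]_n) u : M \in unitmx ->
  cone (Defs.realmx R M) u <-> forall i, 0 <= (Defs.realmx R (invmx M) *m u) i 0.
Proof.
move=> uM; split=> [[c c0 <-] i|u0].
  by rewrite mulmxA realmxVK // mul1mx.
by exists (Defs.realmx R (invmx M) *m u) => //; rewrite mulmxA realmxKV // mul1mx.
Qed.

Lemma cone_add k (A : 'M[R]_(n, k)) u v : cone A u -> cone A v -> cone A (u + v).
Proof.
move=> [c c0 <-] [d d0 <-]; exists (c + d); last by rewrite mulmxDr.
by move=> i /=; rewrite mxE addr_ge0.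
Qed.

(** Full rank makes the linear span the whole space, so the ray generators are a basis of Z^n and
    form a unimodular matrix; [sub_cone_rays] shows that they span the cone. *)
Lemma regular_full C k (A : 'M[int]_(n, k)) : regular_cone C ->
  C = cone (Defs.realmx R A) -> \rank (Defs.realmx R A) = n ->
  exists2 M, M \in unitmx & C = cone (Defs.realmx R M).
Proof.
move=> [_ sc [l [P [rays basis]]]] CE rA.
have span u : linear_span C u.
  exists k, (Defs.realmx R A); split=> [j|]; first by rewrite CE; exact: cone_col.
  have : (u^T <= (Defs.realmx R A)^T)%MS.
    by rewrite submx_full // /row_full mxrank_tr rA.
  case/submxP => c uE; exists c^T; apply: trmx_inj.
  by rewrite uE trmx_mul trmxK.
have [e uP] : exists e : l = n, castmx (erefl n, e) P \in unitmx.
  by apply: basis_unitmx => w; apply: basis; exact: span.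
subst l; rewrite castmx_id in uP; exists P => //.
apply/seteqP; split=> u.
  by rewrite CE; apply: sub_cone_rays => [|v]; rewrite -CE // rays.
have PC j : C (col j (Defs.realmx R P)).
  have [_] : primitive_ray_generator C (col j P) by apply/rays; exists j.
  move=> [a _ FE].
  have : cone (Defs.realmx R (col j P)) (col j (Defs.realmx R P)).
    exists 1; first by move=> i /=; rewrite ord1 mxE.
    by rewrite mulmx1 /Defs.realmx map_col.
  by rewrite FE => -[].
move=> [c c0 <-].
have -> : Defs.realmx R P *m c = \sum_j c j 0 *: col j (Defs.realmx R P).
  by apply/colP => i; rewrite summxE mxE; apply: eq_bigr => j _; rewrite !mxE mulrC.
rewrite CE; elim/big_ind: _ => [|x y|j _].
- by exists 0; [move=> i /=; rewrite mxE | rewrite mulmx0].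
- exact: cone_add.
- have := PC j; rewrite CE => -[d d0 <-]; exists (c j 0 *: d); last by rewrite -scalemxAr.
  by move=> i /=; rewrite mxE mulr_ge0.
Qed.

(** A translated moment curve: it is at [w] for [e = 0], and its distinct positive exponents keep
    every nonzero linear form from vanishing identically on it. *)
Definition curve (w : 'cV[R]_n) (e : R) : 'cV[R]_n := w + \col_i e ^+ i.+1.

Definition curve_poly (a : 'rV[R]_n) (w : 'cV[R]_n) : {poly R} :=
  \sum_j a 0 j *: ((w j 0)%:P + 'X^(j.+1)).

Lemma curve_polyE a w e : (curve_poly a w).[e] = (a *m curve w e) 0 0.
Proof.
rewrite /curve_poly horner_sum mxE; apply: eq_bigr => j _.
by rewrite !hornerE !mxE.
Qed.

Lemma curve_poly_neq0 a w : a != 0 -> curve_poly a w != 0.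
Proof.
move=> /eqP a0; have [j aj] : exists j, a 0 j != 0.
  apply/existsP; apply: contra_notT a0 => /existsPn aj0.
  by apply/rowP => j; rewrite [RHS]mxE; apply/eqP/negPn/aj0.
apply: contraNneq aj => /(congr1 (fun p : {poly R} => p`_j.+1)).
rewrite coef0 coef_sum (bigD1 j) //= big1 => [|i ij].
  by rewrite addr0 coefZ coefD coefC coefXn eqxx add0r mulr1 => ->.
by rewrite coefZ coefD coefC coefXn eqSS val_eqE [j == i]eq_sym (negPf ij) add0r mulr0.
Qed.

(* A curve leaving w with linearly independent Taylor coefficients avoids the
   cones of lower dimension, and those of full dimension that miss w. *)
Lemma full_cone_mem Sigma (w : 'cV[R]_n) : finite_set Sigma ->
  (forall C, Sigma C -> regular_cone C) -> fan_support Sigma = orthant R n ->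
  orthant R n w ->
  exists M, [/\ M \in unitmx, Sigma (cone (Defs.realmx R M)) & cone (Defs.realmx R M) w].
Proof.
move=> fS regS suppS w0; apply: contrapT => noM.
have avoid D : Sigma D -> exists2 d : R, 0 < d & forall e, 0 < e < d -> ~ D (curve w e).
  move=> SD; have [[k [A DE]] _ _] := regS D SD.
  have [rA|rA] := eqVneq (\rank (Defs.realmx R A)) n.
    have [M uM DM] := regular_full (regS D SD) DE rA.
    have /cone_unitP : ~ cone (Defs.realmx R M) w.
      by move=> Mw; apply: noM; exists M; split=> //; rewrite -DM.
    move=> /(_ uM) /existsNP[i /negP]; rewrite -ltNge => Miw.
    pose a := row i (Defs.realmx R (invmx M)).
    have [|d d0 dP] := @poly_lt0_near _ (curve_poly a w).
      rewrite curve_polyE /a -row_mul mxE /curve.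
      have -> : \col_i0 0 ^+ i0.+1 = 0 :> 'cV[R]_n.
        by apply/colP => j; rewrite !mxE exprS mul0r.
      by rewrite addr0.
    exists d => // e /dP; rewrite curve_polyE ltNge DM => /negP ae /cone_unitP.
    by move=> /(_ uM i); move: ae; rewrite /a -row_mul mxE.
  have : kermx (Defs.realmx R A) != 0.
    rewrite -mxrank_eq0 mxrank_ker subn_eq0 -ltnNge.
    by rewrite ltn_neqAle rA rank_leq_row.
  move=> /rowV0Pn[a /sub_kermxP aA a0].
  have [d d0 dP] := poly_neq0_near (curve_poly_neq0 w a0).
  exists d => // e /dP; rewrite curve_polyE DE => ae [c _ cE].
  by move: ae; rewrite -cE mulmxA aA mul0mx mxE eqxx.
have [d d0 dP] : exists2 d : R, 0 < d & forall D, Sigma D ->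
    forall e, 0 < e < d -> ~ D (curve w e).
  have /finite_seqP[s sE] := fS; move: avoid; rewrite sE.
  elim: s {sE} => [|D s IH] avoid; first by exists 1.
  have [|d d0 dP] := IH; first by move=> E Es; apply: avoid; rewrite /= inE Es orbT.
  have [|d' d'0 d'P] := avoid D; first by rewrite /= inE eqxx.
  exists (Num.min d d'); first by rewrite lt_min d0.
  move=> E; rewrite /= inE => /orP[/eqP->|Es] e /andP[e0]; rewrite lt_min => /andP[ed ed'].
    by apply: d'P; rewrite e0.
  by apply: dP => //; rewrite e0.
(* The curve stays in the orthant, which the cones cover, so its point at [d / 2] is a
   contradiction. *)
have : fan_support Sigma (curve w (d / 2)).
  rewrite suppS => i; rewrite !mxE addr_ge0 // ?w0 // exprn_ge0 // divr_ge0 // ltW //.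
move=> [D SD]; apply: dP => //.
by rewrite divr_gt0 // ltr_pdivrMr // mulr_natr mulr2n ltrDr.
Qed.

(** On the cone the supporting functional is a sum of nonnegative terms, so it vanishes exactly on
    combinations of the columns it kills. *)
Lemma face_of_unimodular (M : 'M[int]_n) F : M \in unitmx ->
  is_face F (cone (Defs.realmx R M)) -> exists J, F = subcone (Defs.realmx R M) J.
Proof.
move=> uM [a a0 FE]; set B := Defs.realmx R M.
have aB j : 0 <= (a^T *m B) 0 j.
  by rewrite -dotv_col trmxK; apply/a0/cone_col.
exists [set j | (a^T *m B) 0 j == 0]%SET; rewrite FE; apply/seteqP; split=> u.
  move=> [[c c0 <-] /=]; rewrite -[a in LHS]trmxK dotv_mul => /eqP.
  rewrite psumr_eq0 => [/allP ac0|i _]; last by rewrite mulr_ge0.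
  apply/subconeP; exists c; split=> // i; rewrite inE => aBi.
  have := ac0 i; rewrite mem_index_enum mulf_eq0 (negPf aBi) => /(_ isT).
  by move/eqP.
move=> /subconeP[c [c0 cJ ->]]; split; first by exists c.
rewrite /= -[a]trmxK dotv_mul big1 // => i _.
have [/eqP aBi|aBi] := boolP ((a^T *m B) 0 i == 0); first by rewrite aBi mul0r.
by rewrite cJ ?mulr0 // inE.
Qed.

(** The functional cutting out the face [C]&[D] of [C] vanishes at a combination with all
    coefficients on [J] positive, hence on each generator of [C]; the face is all of [C]. *)
Lemma fan_subset Sigma C D k (A : 'M[R]_(n, k)) (J : {set 'I_k}) (c : 'cV_k) :
  is_fan Sigma -> Sigma C -> Sigma D -> C = subcone A J ->
  (forall i, i \in J -> 0 < c i 0) -> (forall i, i \notin J -> c i 0 = 0) ->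
  D (A *m c) -> C `<=` D.
Proof.
move=> [_ _ _ fanI] SC SD CE c0 cJ Dc.
have [[a a0 FE] _] := fanI _ _ SC SD.
have c_ge0 i : 0 <= c i 0.
  by have [/c0/ltW//|/cJ ->] := boolP (i \in J).
have Cc : C (A *m c) by rewrite CE; apply/subconeP; exists c.
have aA i : i \in J -> 0 <= (a^T *m A) 0 i.
  move=> iJ; rewrite -dotv_col trmxK; apply: a0.
  rewrite CE colE; apply/subconeP; exists (delta_mx i 0); split=> // j.
    by rewrite mxE ler0n.
  by rewrite mxE; case: eqP => // -> /negP.
have : (C `&` D) (A *m c) by [].
rewrite FE => -[_ /eqP]; rewrite -[a in dotv a _]trmxK dotv_mul psumr_eq0 => [/allP ac0|i _].
  suff : C `<=` C `&` D by move=> sub u /sub[].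
  rewrite FE => u Cu; split=> //; move: Cu; rewrite CE => /subconeP[d [d0 dJ ->]].
  rewrite /= -[a]trmxK dotv_mul big1 // => i _.
  have [iJ|/dJ ->] := boolP (i \in J); last by rewrite mulr0.
  have := ac0 i; rewrite mem_index_enum mulf_eq0 (gt_eqF (c0 _ iJ)) orbF => /(_ isT).
  by move=> /eqP ->; rewrite mul0r.
by have [iJ|/cJ ->] := boolP (i \in J); rewrite ?mulr0 // mulr_ge0 // aA.
Qed.

(** The sum [w] of the generators is interior to [C], so a full-dimensional cone through [w]
    contains [C], and [C] is one of its faces. *)
Lemma exists_chart Sigma C : is_fan Sigma ->
  (forall D, Sigma D -> regular_cone D) -> fan_support Sigma = orthant R n ->
  Sigma C -> exists M J,
    [/\ M \in unitmx, Sigma (cone (Defs.realmx R M)) & C = subcone (Defs.realmx R M) J].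
Proof.
move=> fan regS suppS SC; have [fS polyS _ fanI] := fan.
have [k [A CE]] := polyS C SC.
have CT : C = subcone A [set: 'I_k]%SET by rewrite subconeT.
pose w := A *m (const_mx 1 : 'cV_k).
have Cw : C w by rewrite CE; exists (const_mx 1) => // i /=; rewrite mxE.
have [M [uM SM Mw]] : exists M, [/\ M \in unitmx, Sigma (cone (Defs.realmx R M))
    & cone (Defs.realmx R M) w].
  by apply: full_cone_mem => //; rewrite -suppS; exists C.
have CM : C `<=` cone (Defs.realmx R M).
  apply: (fan_subset fan SC SM CT (c := const_mx 1)) => // i; first by rewrite mxE.
  by rewrite inE.
have [_ faceM] := fanI _ _ SC SM.
have [|J CJ] := @face_of_unimodular M C uM.
  suff -> : C = C `&` cone (Defs.realmx R M) by [].
  by apply/seteqP; split=> [u Cu|u []//]; split=> //; apply: CM.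
by exists M, J.
Qed.
End FullCones.

(** * Monomials as integer vectors *)

Section MonomialVectors.
Variable n : nat.
Implicit Types m : 'X_{1..n}.

Definition mnmz m : 'cV[int]_n := \col_i (m i)%:Z.

Lemma mnmzD m1 m2 : mnmz (m1 + m2)%MM = mnmz m1 + mnmz m2.
Proof. by apply/colP => i; rewrite !mxE mnmDE PoszD. Qed.

Lemma mnmz_inj : injective mnmz.
Proof.
by move=> m1 m2 /colP e; apply/mnmP => i; have := e i; rewrite !mxE => -[].
Qed.

Lemma mcoeffMXE (R : nzRingType) (p : {mpoly R[n]}) k m :
  (p * 'X_[k])@_m = if (k <= m)%MM then p@_(m - k) else 0.
Proof.
case: ifP => [km|/negbT km]; first by rewrite -{1}(submK km) addmC mcoeffMX.
apply: memN_msupp_eq0; apply: contra km => /msuppM_le/allpairsP[[m1 m2] /= [_ m2k ->]].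
by move: m2k => /mem_msuppXP <-; rewrite lem_addl.
Qed.

Lemma mcoeff_filter (R : nzRingType) (p : pred 'X_{1..n}) (f : {mpoly R[n]}) m :
  (\sum_(k <- msupp f | p k) f@_k *: 'X_[k])@_m = if p m then f@_m else 0.
Proof.
rewrite raddf_sum /=; under eq_bigr => k _ do rewrite mcoeffZ mcoeffX.
have [mf|/memN_msupp_eq0 mf] := boolP (m \in msupp f); last first.
  rewrite mf if_same big1_seq // => k /andP[_ kf].
  have [km|] := eqVneq k m; last by rewrite mulr0.
  by move: kf; rewrite km mcoeff_msupp mf eqxx.
rewrite big_mkcond (bigD1_seq m) ?msupp_uniq //= eqxx mulr1.
rewrite big1 ?addr0 // => k /negPf km.
by rewrite km mulr0 if_same.
Qed.
End MonomialVectors.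

(** * Initial monomials and closedness of the tropical variety *)

Section InitialMonomials.
Variables (R : realType) (K : fieldType) (n : nat).
Implicit Types (I : set {mpoly K[n]}) (w u v : 'cV[R]_n) (f g h : {mpoly K[n]}).
Implicit Types m : 'X_{1..n}.

Lemma idealN I f : is_ideal I -> I f -> I (- f).
Proof. by move=> [_ _ IM] If; rewrite -mulN1r; apply: IM. Qed.

Lemma idealB I f g : is_ideal I -> I f -> I g -> I (f - g).
Proof. by move=> hI If Ig; have [_ ID _] := hI; apply: ID => //; apply: idealN. Qed.

Lemma idealZ I c f : is_ideal I -> I f -> I (c *: f).
Proof. by move=> [_ _ IM] If; rewrite -mul_mpolyC; apply: IM. Qed.

Lemma idealMr I f g : is_ideal I -> I f -> I (f * g).
Proof. by move=> [_ _ IM] If; rewrite mulrC; apply: IM. Qed.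

Lemma ideal_gen_is_ideal (G : set {mpoly K[n]}) : is_ideal (ideal_gen G).
Proof.
split=> [J [[J0]]//|f g If Ig J JP|f g Ig J JP].
  by have [[_ JD _] _] := JP; apply: JD; [apply: If | apply: Ig].
by have [[_ _ JM] _] := JP; apply: JM; apply: Ig.
Qed.

Lemma wdotE w m : wdot w m = dotv w (Defs.realmx R (mnmz m)).
Proof. by apply: eq_bigr => i _; rewrite !mxE mulr_natr. Qed.

Lemma wdotD w m1 m2 : wdot w (m1 + m2)%MM = wdot w m1 + wdot w m2.
Proof. by rewrite /wdot -big_split; apply: eq_bigr => i _; rewrite mnmDE mulrnDr. Qed.

Lemma wdotB w m1 m2 : (m2 <= m1)%MM -> wdot w (m1 - m2)%MM = wdot w m1 - wdot w m2.
Proof. by move=> le21; rewrite -{2}(submK le21) wdotD addrK. Qed.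

Lemma weight_order_le w f m : m \in msupp f -> weight_order w f <= wdot w m.
Proof. by move=> mf; apply: ge_bigmin_seq. Qed.

Lemma weight_order_ge w f m : m \in msupp f ->
  (forall k, k \in msupp f -> wdot w m <= wdot w k) -> weight_order w f = wdot w m.
Proof.
move=> mf mmin; apply/le_anti; rewrite weight_order_le //=.
rewrite /weight_order big_seq; elim/big_ind: _ => [|x y mx my|k kf].
- by apply/mmin/mlead_supp; apply: contraTneq mf => ->; rewrite msupp0.
- by rewrite le_min mx.
- exact: mmin.
Qed.

Lemma mcoeff_initial_form w f m :
  (initial_form w f)@_m = if wdot w m == weight_order w f then f@_m else 0.
Proof. by rewrite /initial_form mcoeff_filter. Qed.

Definition initial_monomial w f m :=
  f@_m != 0 /\ forall k, k \in msupp f -> k != m -> wdot w m < wdot w k.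

Lemma initial_monomial_form w f m : initial_monomial w f m ->
  initial_form w f = f@_m *: 'X_[m].
Proof.
move=> [fm mmin]; have mf : m \in msupp f by rewrite mcoeff_msupp.
have le_m k : k \in msupp f -> wdot w m <= wdot w k.
  by move=> kf; have [->//|km] := eqVneq k m; apply/ltW/mmin.
apply/mpolyP => k; rewrite mcoeff_initial_form (weight_order_ge mf le_m).
rewrite mcoeffZ mcoeffX [m == k]eq_sym; have [->|km] := eqVneq k m.
  by rewrite eqxx mulr1.
rewrite mulr0; case: eqP => // wkm; apply: memN_msupp_eq0.
by apply/negP => /mmin /(_ km); rewrite wkm ltxx.
Qed.

(* The graded components of an element of the initial ideal are initial forms
   of elements of I (or 0). *)
Lemma initial_ideal_component w I h : is_ideal I -> initial_ideal w I h ->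
  forall a, exists2 f, I f &
    forall m, (wdot w m < a -> f@_m = 0) /\ (wdot w m = a -> f@_m = h@_m).
Proof.
move=> hI; have [I0 ID IM] := hI; move=> /(_ [set h | forall a, exists2 f, I f &
  forall m, (wdot w m < a -> f@_m = 0) /\ (wdot w m = a -> f@_m = h@_m)]); apply.
split; last first.
  move=> _ [f [If /eqP f0] <-] a /=.
  have [aE|aN] := eqVneq a (weight_order w f); last first.
    exists 0 => // m; rewrite mcoeff0; split=> // wm.
    by rewrite mcoeff_initial_form wm (negPf aN).
  exists f => // m; split=> [wm|wm].
    apply/memN_msupp_eq0; apply/negP => /(weight_order_le w).
    by rewrite leNgt -aE wm.
  by rewrite mcoeff_initial_form wm aE eqxx.
pose Q h := forall a, exists2 f, I f &
  forall m, (wdot w m < a -> f@_m = 0) /\ (wdot w m = a -> f@_m = h@_m).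
have Q0 : Q 0 by move=> a; exists 0 => // m; rewrite mcoeff0.
have QD f g : Q f -> Q g -> Q (f + g).
  move=> Qf Qg a; have [f' If' f'P] := Qf a; have [g' Ig' g'P] := Qg a.
  exists (f' + g'); first exact: ID.
  move=> m; have [f1 f2] := f'P m; have [g1 g2] := g'P m.
  rewrite !mcoeffD; split=> wm; first by rewrite f1 // g1 // addr0.
  by rewrite f2 // g2.
(* Multiplication by a monomial ['X_[k]] shifts weights by [wdot w k], whence the level
   [a - wdot w k] for [g]. *)
split=> // f g Qg; rewrite [f]mpolyE mulr_suml.
apply: (big_ind Q) => // k _ a.
have [g' Ig' g'P] := Qg (a - wdot w k).
exists (f@_k *: (g' * 'X_[k])); first by apply: idealZ => //; exact: idealMr.
move=> m; rewrite -scalerAl !mcoeffZ ['X_[k] * g]mulrC !mcoeffMXE.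
case: ifP => km; last by rewrite !mulr0.
have [g1 g2] := g'P (m - k)%MM; rewrite wdotB // in g1 g2.
split=> wm; first by rewrite g1 ?mulr0 // ltrD2r.
by rewrite g2 // wm.
Qed.

(** The component of ['X_[m]] of weight [wdot w m] lifts to an [f] in [I] with no term of lower
    weight and only ['X_[m]] in that weight. *)
Lemma initial_ideal_monomialP w I m : is_ideal I ->
  initial_ideal w I 'X_[m] <-> exists2 f, I f & initial_monomial w f m.
Proof.
move=> hI; split=> [/(initial_ideal_component hI)/(_ (wdot w m))[f If fP]|[f If fm]].
  have fm : f@_m = 1 by have [_ ->] := fP m; rewrite ?mcoeffX ?eqxx.
  exists f => //; split=> [|k kf km]; first by rewrite fm oner_neq0.
  move: kf; rewrite mcoeff_msupp; case: ltgtP => // wk; have [f1 f2] := fP k.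
    by rewrite f1 ?eqxx.
  by rewrite f2 // mcoeffX [m == k]eq_sym (negPf km) eqxx.
have f0 : f@_m != 0 by case: fm.
rewrite -['X_[m]]scale1r -(mulVf f0) -scalerA -(initial_monomial_form fm).
rewrite /initial_ideal; apply: (idealZ _ (ideal_gen_is_ideal _)).
move=> J [_]; apply; exists f => //; split=> //=.
by move=> f_eq0; move: f0; rewrite f_eq0 mcoeff0 eqxx.
Qed.

Lemma tropical_varietyP I w : is_ideal I -> tropical_variety R I w <->
  forall f m, I f -> ~ initial_monomial w f m.
Proof.
move=> hI; split=> [Tw f m If fm|Tw m /(initial_ideal_monomialP _ _ hI)[f If]].
  by apply: (Tw m); apply/initial_ideal_monomialP => //; exists f.
exact: Tw.
Qed.

Lemma initial_monomial_near f m w : initial_monomial w f m ->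
  nbhs w [set v | initial_monomial v f m].
Proof.
move=> [fm mmin].
have [e e0 eP] : exists2 e : R, 0 < e & forall k, k \in msupp f -> k != m ->
    forall v, (forall i, `|w i 0 - v i 0| < e) -> wdot v m < wdot v k.
  elim: (msupp f) mmin => [|k s IH] mmin; first by exists 1.
  have [|e e0 eP] := IH; first by move=> l ls; apply: mmin; rewrite inE ls orbT.
  have [km|km] := eqVneq k m.
    by exists e => // l; rewrite inE => /orP[/eqP->|]; rewrite ?km ?eqxx //; exact: eP.
  have wkm : 0 < wdot w k - wdot w m by rewrite subr_gt0 mmin // inE eqxx.
  (* [S] bounds the l1-norm of [k - m]: moving each coordinate of [w] by at most [d] changes the
     difference of weights by at most [d * S]. *)
  pose S : R := \sum_i ((m i)%:R + (k i)%:R).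
  have S0 : 0 <= S by apply: sumr_ge0 => i _; rewrite addr_ge0.
  have [d d0 dS] : exists2 d, 0 < d & d * S < wdot w k - wdot w m.
    exists ((wdot w k - wdot w m) / (S + 1)); first by rewrite divr_gt0 // ltr_wpDl.
    by rewrite mulrAC -mulrA gtr_pMr // ltr_pdivrMr ?ltr_wpDl // mul1r ltrDl.
  exists (Num.min e d); first by rewrite lt_min e0.
  move=> l; rewrite inE => /predU1P[->{l} _|ls lm] v vw; last first.
    by apply: (eP l ls lm) => i; apply: lt_le_trans (vw i) _; rewrite ge_min lexx.
  have le_d : `|(wdot w k - wdot w m) - (wdot v k - wdot v m)| <= d * S.
    have -> : (wdot w k - wdot w m) - (wdot v k - wdot v m)
        = \sum_i (w i 0 - v i 0) * ((k i)%:R - (m i)%:R).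
      rewrite /wdot -!sumrB; apply: eq_bigr => i _.
      rewrite -!(mulr_natr (w i 0)) -!(mulr_natr (v i 0)).
      by move: (w i 0) (v i 0) (k i)%:R (m i)%:R => x y a b; ring.
    rewrite mulr_sumr; apply: le_trans (ler_norm_sum _ _ _) _.
    apply: (@ler_sum R) => i _; rewrite normrM; apply: ler_pM => //.
      by apply: ltW; apply: lt_le_trans (vw i) _; rewrite ge_min lexx orbT.
    by apply: le_trans (ler_normB _ _) _; rewrite !ger0_norm ?ler0n // addrC.
  rewrite -subr_gt0; move: le_d; rewrite ler_norml => /andP[_].
  by move: dS; lra.
exists (fun i j => [set x | `|w i j - x| < e]).
  by move=> i j; apply/nbhs_ballP; exists e.
move=> v vw; split=> // k kf km; apply: (eP k kf km) => i; exact: vw.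
Qed.

(** Having an initial monomial is an open condition on the weight, so a failure at [u] in the
    closure passes to a nearby weight whose initial ideal is that of [w]. *)
Lemma groebner_cone_tropical I w : is_ideal I -> tropical_variety R I w ->
  groebner_cone I w `<=` tropical_variety R I.
Proof.
move=> hI Tw u cu; apply/tropical_varietyP => // f m If /initial_monomial_near.
move=> /cu[v [/= vw fm]]; apply: (Tw m); rewrite -vw.
by apply/initial_ideal_monomialP => //; exists f.
Qed.

Lemma groebner_cone_refl I w : groebner_cone I w w.
Proof. exact: subset_closure. Qed.

End InitialMonomials.

(** * Lifting zeros of prime ideals along one more variable *)

Section PrimeExtension.
Variables (A : idomainType) (K : closedFieldType).

Record prime_ideal (B : comNzRingType) (P : set B) : Prop := PrimeIdeal {
  pideal0 : P 0;
  pidealD : forall f g, P f -> P g -> P (f + g);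
  pidealM : forall f g, P g -> P (f * g);
  pideal1 : ~ P 1;
  pidealP : forall f g, P (f * g) -> P f \/ P g }.

Lemma pidealN (B : comNzRingType) (P : set B) f : prime_ideal P -> P f -> P (- f).
Proof. by move=> hP Pf; rewrite -mulN1r; apply: (pidealM hP). Qed.

Lemma pideal_exp (B : comNzRingType) (P : set B) f k : prime_ideal P -> P (f ^+ k) -> P f.
Proof.
move=> hP; elim: k => [/(pideal1 hP)//|k IH].
by rewrite exprS => /(pidealP hP)[].
Qed.

Variable P : set {poly A}.
Hypothesis hP : prime_ideal P.

(** Membership in the extension to [A[X]] of the contraction of [P] to [A]. *)
Let coefsP (f : {poly A}) := forall i, P (f`_i)%:P.

Let coefsPP f : coefsP f -> P f.
Proof.
move=> cf; rewrite -[f]coefK poly_def; apply: (big_ind P).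
- exact: (pideal0 hP).
- exact: (pidealD hP).
- by move=> i _; rewrite -mul_polyC mulrC; apply: (pidealM hP).
Qed.

Let coefsP_small (Q : set {poly A}) k : P `<=` Q ->
    (forall f g, Q f -> Q g -> Q (f - g)) ->
    (forall f, Q f -> (size f <= k)%N -> P (lead_coef f)%:P) ->
  forall f, Q f -> (size f <= k)%N -> coefsP f.
Proof.
move=> PQ QB Qlead f; have [s] := ubnP (size f); elim: s f => // s IH f fs Qf fk.
have [f0|f0] := eqVneq f 0; first by rewrite f0 => i; rewrite coef0; exact: (pideal0 hP).
pose g := lead_coef f *: 'X^((size f).-1).
have cg : coefsP g.
  move=> i; rewrite coefZ coefXn; case: (i == _); rewrite ?mulr1 ?mulr0; last exact: (pideal0 hP).
  exact: Qlead.
have sfg : (size (f - g)%R < size f)%N.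
  rewrite -[size f]prednK ?size_poly_gt0 // ltnS.
  apply/leq_sizeP => j; rewrite leq_eqVlt => /predU1P[<-|ltj].
    by rewrite coefB coefZ coefXn eqxx mulr1 subrr.
  rewrite coefB coefZ coefXn gtn_eqF // mulr0 subr0 nth_default //.
  by rewrite -[size f]prednK ?size_poly_gt0.
have cfg : coefsP (f - g).
  apply: IH; first exact: leq_trans sfg fs.
    by apply: QB => //; apply/PQ/coefsPP.
  exact: leq_trans (ltnW sfg) fk.
by move=> i; rewrite -(subrK g f) coefD polyCD; apply: (pidealD hP).
Qed.

(* Every point of the contraction of P to A outside a hypersurface lifts to a
   point of P: the fibre is cut out by an element g of P that has minimal degree
   modulo the contraction, and beta is invertible modulo g up to a constant. *)
Lemma prime_extension (beta : {poly A}) : ~ P beta ->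
  exists2 alpha, ~ P alpha%:P & forall e : {rmorphism A -> K},
    (forall a, P a%:P -> e a = 0) -> e alpha != 0 ->
    exists2 c, forall f, P f -> (map_poly e f).[c] = 0 & (map_poly e beta).[c] != 0.
Proof.
move=> Pbeta.
have PB f g : P f -> P g -> P (f - g) by move=> Pf Pg; apply: (pidealD hP) => //; apply: pidealN.
have map0 (e : {rmorphism A -> K}) f : (forall a, P a%:P -> e a = 0) ->
    coefsP f -> map_poly e f = 0.
  by move=> e0 cf; apply/polyP => i; rewrite coef_map coef0; apply: e0.
(* [g] is an element of [P] of least size with leading coefficient outside [P]. If there is none,
   [P] is extended from [A], and a coefficient of [beta] outside [P] serves as [alpha]. *)
have [exg|nex] := pselect
  (exists n, `[< exists f, [/\ P f, ~ P (lead_coef f)%:P & size f = n] >]); last first.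
  have allP f : P f -> coefsP f.
    move=> Pf; apply: (@coefsP_small P (size f)) => // g Pg _.
    apply: contrapT => lg; apply: nex; exists (size g); apply/asboolP.
    by exists g.
  have [i bi] : exists i, ~ P (beta`_i)%:P.
    by apply/existsNP => cb; apply/Pbeta/coefsPP.
  exists beta`_i => // e e0 ebi.
  have /closed_nonrootP[c] : map_poly e beta != 0.
    by apply: contraNneq ebi => /polyP/(_ i); rewrite coef_map coef0 => ->.
  by exists c => // f /allP/map0 ->; rewrite ?horner0.
case: (ex_minnP exg) => _ /asboolP[g [Pg lg <-]] ming {exg}.
have small_P f : P f -> (size f < size g)%N -> coefsP f.
  move=> Pf fg; apply: (@coefsP_small P (size f)) => // h Ph hf.
  apply: contrapT => lh; have : (size g <= size h)%N.
    by apply: ming; apply/asboolP; exists h.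
  by rewrite leqNgt (leq_ltn_trans hf fg).
(* The ideal generated by [P] and [beta]. Its element [h] of least size with leading coefficient
   outside [P] will be a constant, congruent to a multiple of [beta] modulo [P]. *)
pose Q f := exists u p, P p /\ f = u * beta + p.
have PQ : P `<=` Q by move=> p Pp; exists 0, p; rewrite mul0r add0r.
have QB f h : Q f -> Q h -> Q (f - h).
  move=> [u [p [Pp ->]]] [v [q [Pq ->]]]; exists (u - v), (p - q).
  by split; [exact: PB | ring].
have QM f h : Q h -> Q (f * h).
  move=> [u [p [Pp ->]]]; exists (f * u), (f * p); split; first exact: (pidealM hP).
  by ring.
have Qbeta : Q beta by exists 1, 0; split; [exact: (pideal0 hP) | rewrite mul1r addr0].
have exh : exists n, `[< exists f, [/\ Q f, ~ P (lead_coef f)%:P & size f = n] >].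
  by exists (size g); apply/asboolP; exists g; split=> //; exact: PQ.
case: (ex_minnP exh) => _ /asboolP[h [Qh lh <-]] minh {exh}.
have small_Q f : Q f -> (size f < size h)%N -> coefsP f.
  move=> Qf fh; apply: (@coefsP_small Q (size f)) => // r Qr rf.
  apply: contrapT => lr; have : (size h <= size r)%N.
    by apply: minh; apply/asboolP; exists r.
  by rewrite leqNgt (leq_ltn_trans rf fh).
have h0 : h != 0 by apply: contra_notN lh => /eqP->; rewrite lead_coef0; exact: (pideal0 hP).
have g0 : g != 0 by apply: contra_notN lg => /eqP->; rewrite lead_coef0; exact: (pideal0 hP).
have lk k : ~ P (lead_coef h ^+ k)%:P.
  by rewrite polyC_exp => /(pideal_exp hP).
have divh f : Q f -> exists k w, [/\ P (lead_coef h ^+ k *: f - w * h),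
    coefsP (lead_coef h ^+ k *: f - w * h) & (size (lead_coef h ^+ k *: f - w * h)%R < size h)%N].
  move=> Qf; exists (scalp f h), (f %/ h); rewrite Pdiv.Idomain.divp_eq addrC addKr.
  have sm : (size (f %% h)%R < size h)%N by rewrite Pdiv.Idomain.ltn_modp.
  have cm : coefsP (f %% h).
    apply: small_Q sm; rewrite -(addKr (f %/ h * h) (f %% h)) -Pdiv.Idomain.divp_eq addrC.
    by apply: QB; [rewrite -mul_polyC; apply: QM | apply: QM].
  by split=> //; exact: coefsPP.
have Ph : ~ P h.
  move=> Ph; have [k [w [Pr _ _]]] := divh _ Qbeta.
  have : P ((lead_coef h ^+ k)%:P * beta).
    by rewrite mul_polyC -(subrK (w * h) (_ *: _)); apply: (pidealD hP) => //; apply: (pidealM hP).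
  by move=> /(pidealP hP)[/lk|].
(* Dividing [g] by [h] puts the quotient [w] in [P]. If [w] were shorter than [g], the leading
   coefficient of [g] times a power of that of [h] would lie in [P]; otherwise comparing sizes makes
   [h] constant. *)
have sh : (size h <= 1)%N.
  have [k [w [Pr cr sr]]] := divh _ (PQ _ Pg).
  have Pwh : P (w * h).
    rewrite -(subKr (lead_coef h ^+ k *: g) (w * h)); apply: PB => //.
    by rewrite -mul_polyC; apply: (pidealM hP).
  have Pw : P w by case/(pidealP hP): Pwh.
  have hg : (size h <= size g)%N.
    by apply: minh; apply/asboolP; exists g; split=> //; exact: PQ.
  have [sw|sw] := ltnP (size w) (size g).
    have cw := small_P w Pw sw; exfalso.
    have cwh : coefsP (w * h).
      move=> i; rewrite coefM rmorph_sum /=; apply: (big_ind P).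
      - exact: (pideal0 hP).
      - exact: (pidealD hP).
      - by move=> j _; rewrite polyCM mulrC; apply: (pidealM hP).
    have : P ((lead_coef h ^+ k)%:P * (lead_coef g)%:P).
      rewrite -polyCM lead_coefE -coefZ -(subrK (w * h) (_ *: _)) coefD polyCD.
      exact: (pidealD hP).
    by move=> /(pidealP hP)[/lk|].
  have w0 : w != 0 by rewrite -size_poly_gt0 (leq_trans _ sw) // size_poly_gt0.
  have : (size (w * h)%R <= size g)%N.
    rewrite -(subKr (lead_coef h ^+ k *: g) (w * h)).
    apply: leq_trans (size_polyD _ _) _; rewrite size_polyN geq_max.
    rewrite (leq_trans (size_scale_leq _ _)) //=.
    exact: leq_trans (ltnW sr) hg.
  rewrite size_mul // => wh; have : ((size w + size h).-1 <= size w)%N by apply: leq_trans sw.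
  by move: w0; rewrite -size_poly_gt0; lia.
have sg : (1 < size g)%N.
  rewrite ltnNge; apply/negP => /size1_polyC gE.
  by apply: lg; rewrite gE lead_coefC -gE.
(* The first factor preserves the degree of [g] under [e], giving a root [c]; the second, equal to
   [h], keeps [beta] nonzero at [c]. *)
exists (lead_coef g * lead_coef h); first by rewrite polyCM => /(pidealP hP)[].
move=> e e0; rewrite rmorphM mulf_eq0 negb_or => /andP[eg eh].
have smg : size (map_poly e g) = size g by rewrite size_map_poly_id0.
have /closed_rootP[c /rootP gc] : size (map_poly e g) != 1 by rewrite smg gtn_eqF.
have Pc f : P f -> (map_poly e f).[c] = 0.
  move=> Pf.
  have rE := Pdiv.Idomain.divp_eq f g.
  have cr : coefsP (f %% g).
    apply: small_P; last by rewrite Pdiv.Idomain.ltn_modp.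
    rewrite -(addKr (f %/ g * g) (f %% g)) -rE addrC.
    by apply: PB; [rewrite -mul_polyC|]; apply: (pidealM hP).
  have := congr1 (fun p => (map_poly e p).[c]) rE.
  rewrite /= rmorphD rmorphM /= (map0 e _ e0 cr) addr0 hornerM gc mulr0.
  rewrite map_polyZ hornerZ rmorphXn => /eqP.
  by rewrite mulf_eq0 expf_eq0 (negPf eg) andbF /= => /eqP.
exists c => //; have [u [p [/Pc pc hE]]] := Qh.
have hC : h = (lead_coef h)%:P by rewrite {1}(size1_polyC sh) {2}(size1_polyC sh) lead_coefC.
have := congr1 (fun p => (map_poly e p).[c]) hE.
rewrite /= {1}hC map_polyC hornerC rmorphD rmorphM /= hornerD pc addr0 hornerM => hc.
by apply: contraNneq eh => bc; rewrite hc bc mulr0.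
Qed.
End PrimeExtension.

(** * Hilbert's Nullstellensatz *)

Section Nullstellensatz.
Variable K : closedFieldType.

Definition mpoly_join n : {poly {mpoly K[n]}} -> {mpoly K[n.+1]} :=
  horner_eval 'X_ord_max \o map_poly (@mwiden n K).

HB.instance Definition _ n := GRing.RMorphism.on (@mpoly_join n).

Lemma mpoly_joinE n (F : {poly {mpoly K[n]}}) :
  mpoly_join F = (map_poly (@mwiden n K) F).['X_ord_max].
Proof. by []. Qed.

Lemma mpoly_join_surj n (f : {mpoly K[n.+1]}) : exists F, mpoly_join F = f.
Proof.
elim/mpolyind: f => [|c m f _ _ [F <-]]; first by exists 0; rewrite rmorph0.
pose m' := [multinom m (widen_ord (leqnSn n) i) | i < n].
exists (c *: 'X_[m'] *: 'X^(m ord_max) + F); rewrite rmorphD; congr (_ + _).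
rewrite [LHS]mpoly_joinE map_polyZ map_polyXn hornerZ hornerXn /=.
rewrite mwidenZ mwidenX -scalerAl; congr (_ *: _).
rewrite mpolyXn -mpolyXD; congr 'X_[_]; apply/mnmP => i.
rewrite mnmDE mulmnE mnm1E; case: (unliftP ord_max i) => [j ->|->].
  have -> : lift ord_max j = widen_ord (leqnSn n) j by apply/val_inj; rewrite /= /bump leqNgt ltn_ord.
  rewrite mnmwiden_widen mnmE -val_eqE /= gtn_eqF ?ltn_ord //.
  by rewrite mul0n addn0.
by rewrite mnmwiden_ordmax eqxx mul1n.
Qed.

Lemma mpoly_join_meval n (F : {poly {mpoly K[n]}}) (z : 'I_n.+1 -> K) :
  (mpoly_join F).@[z] =
  (map_poly (meval (fun i => z (widen_ord (leqnSn n) i))) F).[z ord_max].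
Proof.
rewrite mpoly_joinE -{1}[F]coefK poly_def.
rewrite rmorph_sum horner_sum (raddf_sum (meval z)) horner_poly.
apply: eq_bigr => i _; rewrite /= map_polyZ map_polyXn hornerZ hornerXn.
rewrite mevalM rmorphXn /= mevalXU; congr (_ * _).
elim/mpolyind: F`_i => [|c m f _ _ IH]; first by rewrite mwiden0 !meval0.
rewrite mwidenD mwidenZ mwidenX !mevalD !mevalZ IH !mevalX; congr (_ * _ + _).
rewrite big_ord_recr /= mnmwiden_ordmax expr0 mulr1.
by apply: eq_bigr => j _; rewrite mnmwiden_widen.
Qed.

(** Induction on [n]: a zero of the contraction of [P] to the first variables, chosen off [alpha],
    is lifted by [prime_extension]. Without variables, a prime ideal contains only 0. *)
Lemma prime_zero n (P : set {mpoly K[n]}) beta : prime_ideal P -> ~ P beta ->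
  exists2 z, forall f, P f -> f.@[z] = 0 & beta.@[z] != 0.
Proof.
elim: n P beta => [|n IH] P beta hP Pbeta.
  have unit_P (f : {mpoly K[0]}) : P f -> f = 0.
    move=> Pf; rewrite [f]nvar0_mpolyC; apply/eqP; rewrite mpolyC_eq0.
    apply: contraPT Pf => f0 Pf; apply: (pideal1 hP).
    rewrite -mpolyC1 -(mulVf f0) mpolyCM -nvar0_mpolyC; exact: (pidealM hP).
  exists (fun=> 0) => [f /unit_P->|]; first by rewrite meval0.
  apply: contra_notN Pbeta; rewrite [beta]nvar0_mpolyC mevalC => /eqP ->.
  by rewrite mpolyC0; exact: (pideal0 hP).
have hP' : prime_ideal (P \o @mpoly_join n).
  split=> /= [|f g|f g||f g]; rewrite ?rmorph0 ?rmorph1 ?rmorphD ?rmorphM.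
  - exact: (pideal0 hP).
  - exact: (pidealD hP).
  - exact: (pidealM hP).
  - exact: (pideal1 hP).
  - exact: (pidealP hP).
have [B BE] := mpoly_join_surj beta.
have [|alpha Palpha ext] := prime_extension K hP' (beta := B); first by rewrite /= BE.
have hP0 : prime_ideal (fun a => P (mpoly_join a%:P)).
  split=> [|f g|f g||f g]; rewrite ?polyC0 ?polyC1 ?polyCD ?polyCM ?rmorph0 ?rmorph1 ?rmorphD ?rmorphM.
  - exact: (pideal0 hP).
  - exact: (pidealD hP).
  - exact: (pidealM hP).
  - exact: (pideal1 hP).
  - exact: (pidealP hP).
have [z zP za] := IH _ _ hP0 Palpha.
have [c cP cB] := ext (meval z) zP za.
pose z' i := if unlift ord_max i is Some j then z j else c.
have z'w : (fun i => z' (widen_ord (leqnSn n) i)) =1 z.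
  move=> i; rewrite /z'.
  have -> : widen_ord (leqnSn n) i = lift ord_max i by apply/val_inj; rewrite /= /bump leqNgt ltn_ord.
  by rewrite liftK.
have z'E F : (mpoly_join F).@[z'] = (map_poly (meval z) F).[c].
  rewrite mpoly_join_meval {2}/z' unlift_none; congr (_.[_]).
  by apply/polyP => i; rewrite !coef_map; apply: meval_eq.
exists z' => [f|]; last by rewrite -BE z'E.
by have [F <-] := mpoly_join_surj f; rewrite z'E; exact: cP.
Qed.

(** An ideal containing [I] and maximal among those that avoid the powers of [h] is prime. *)
Lemma prime_avoiding n (I : set {mpoly K[n]}) h : is_ideal I ->
  (forall k, ~ I (h ^+ k)) ->
  exists P, [/\ prime_ideal P, I `<=` P & ~ P h].
Proof.
move=> hI Ih.
(* Adjoining [I] to each set makes the condition hold for the union of the empty chain. *)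
pose J (A : set {mpoly K[n]}) := is_ideal (A `|` I) /\ forall k, ~ (A `|` I) (h ^+ k).
have [F FJ Ftot|P [[hP Ph] maxP]] := @Zorn_bigcup _ J.
  have [[A0 FA0]|F0] := pselect (exists A, F A); last first.
    rewrite /J; suff -> : (\bigcup_(X in F) X) `|` I = I by [].
    
    by apply/seteqP; split=> f; [case=> // -[A FA]; case: F0; exists A | right].
  have UE f : ((\bigcup_(X in F) X) `|` I) f <-> exists2 A, F A & (A `|` I) f.
    split=> [[[A FA Af]|If]|[A FA [Af|If]]]; [by exists A => //; left|
      by exists A0 => //; right|by left; exists A|by right].
  split; last by move=> k /UE[A FA]; have [_] := FJ A FA; apply.
  split.
  - by right; case: hI.
  - move=> f g /UE[A FA Af] /UE[B FB Bg]; apply/UE.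
    have [AB|BA] := Ftot A B FA FB.
      exists B => //; have [[_ BD _] _] := FJ B FB; apply: BD => //.
      by case: Af => [/AB|]; [left|right].
    exists A => //; have [[_ AD _] _] := FJ A FA; apply: AD => //.
    by case: Bg => [/BA|]; [left|right].
  - by move=> f g /UE[A FA Ag]; apply/UE; exists A => //; have [[_ _ +] _] := FJ A FA; apply.
set Q := P `|` I; have [Q0 QD QM] := hP.
exists Q; split; [|by right|by have := Ph 1%N; rewrite expr1].
have pow a : ~ Q a -> exists k q b, Q q /\ h ^+ k = q + b * a.
  move=> Qa; apply: contrapT => noh.
  pose Qa' := [set f | exists q b, Q q /\ f = q + b * a].
  apply: (maxP Qa'); first split.
  - by move=> f Pf; exists f, 0; split; [left|rewrite mul0r addr0].
  - move=> PQ; apply: Qa; left; apply: PQ; exists 0, 1; split=> //.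
    by rewrite add0r mul1r.
  suff QaI : Qa' `|` I = Qa'.
    rewrite /J QaI; split; last first.
      by move=> k [q [b [Qq hk]]]; apply: noh; exists k, q, b.
    split.
    - by exists 0, 0; split=> //; rewrite mul0r addr0.
    - move=> f g [q [b [Qq ->]]] [r [c [Qr ->]]]; exists (q + r), (b + c).
      by split; [exact: QD | ring].
    - move=> f g [q [b [Qq ->]]]; exists (f * q), (f * b).
      by split; [exact: QM | ring].
  apply/seteqP; split=> f; last by left.
  by case=> // If; exists f, 0; split; [right|rewrite mul0r addr0].
split=> //.
- by have := Ph 0%N; rewrite expr0.
- move=> f g Qfg; apply: contrapT => /not_orP[/pow[k [q [b [Qq hk]]]]].
  move=> /pow[l [r [c [Qr hl]]]]; apply: (Ph (k + l)%N); rewrite -/Q exprD hk hl.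
  have -> : (q + b * f) * (r + c * g) = (r + c * g) * q + (b * f) * r + (b * c) * (f * g) by ring.
  by apply: (QD); [apply: (QD)|]; apply: (QM).
Qed.

Theorem nullstellensatz n (I : set {mpoly K[n]}) h : is_ideal I ->
  (forall z, zero_set I z -> peval h z = 0) -> exists k, I (h ^+ k).
Proof.
move=> hI hz; apply: contrapT => /forallNP Ih.
have [P [hP IP Ph]] := prime_avoiding hI Ih.
have [z zP /eqP] := prime_zero hP Ph; apply.
have zE f : peval f (\col_i z i) = f.@[z] by apply: meval_eq => i; rewrite mxE.
by rewrite -zE; apply: hz => f /IP/zP; rewrite zE.
Qed.
End Nullstellensatz.

(** * Maximal preorders on exponents for which the ideal stays irreducible *)

Section Preorders.
Variables (K : fieldType) (n : nat) (I : set {mpoly K[n]}).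
Hypothesis hI : is_ideal I.
Implicit Types (A B P : set 'cV[int]_n) (f g : {mpoly K[n]}) (m : 'X_{1..n}).
Implicit Types a s : 'cV[int]_n.

(** The pair [m], [f] encodes the Laurent polynomial [f / x^m], whose exponents are required to lie
    in [A]. *)
Definition supp_in A m f := forall k, k \in msupp f -> A (mnmz k - mnmz m).

(* In the Laurent polynomial ring: 1 is congruent modulo I to a combination of
   monomials with exponents in A. *)
Definition reducible A := exists m f, I ('X_[m] - f) /\ supp_in A m f.

Lemma supp_inS A B m f : A `<=` B -> supp_in A m f -> supp_in B m f.
Proof. by move=> AB Af k /Af/AB. Qed.

Lemma supp_inD A m f g : supp_in A m f -> supp_in A m g -> supp_in A m (f + g).
Proof. by move=> Af Ag k /msuppD_le; rewrite mem_cat => /orP[/Af|/Ag]. Qed.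

Lemma supp_inN A m f : supp_in A m f -> supp_in A m (- f).
Proof. by move=> Af k; rewrite (perm_mem (msuppN _)) => /Af. Qed.

Lemma supp_inM A B C m m' f g : (forall a b, A a -> B b -> C (a + b)) ->
  supp_in A m f -> supp_in B m' g -> supp_in C (m + m')%MM (f * g).
Proof.
move=> ABC Af Bg k /msuppM_le/allpairsP[[k1 k2] /= [/Af Ak1 /Bg Bk2 ->]].
by rewrite !mnmzD opprD addrACA; apply: ABC.
Qed.

Lemma supp_in_X m : supp_in [set 0] m 'X_[m].
Proof. by move=> k /mem_msuppXP <-; rewrite subrr. Qed.

Lemma supp_in_split A B m f : supp_in (A `|` B) m f ->
  exists f0 f1, [/\ f = f0 + f1, supp_in A m f0 & supp_in B m f1].
Proof.
move=> ABf; pose p k := `[< A (mnmz k - mnmz m) >].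
pose F (q : pred 'X_{1..n}) := \sum_(k <- msupp f | q k) f@_k *: 'X_[k].
have suppF (q : pred 'X_{1..n}) k : k \in msupp (F q) -> q k /\ k \in msupp f.
  by rewrite !mcoeff_msupp mcoeff_filter; case: (q k) => //; rewrite eqxx.
exists (F p), (F (predC p)); split.
- apply/mpolyP => k; rewrite mcoeffD !mcoeff_filter /=.
  by case: (p k); rewrite ?addr0 ?add0r.
- by move=> k /suppF[/asboolP].
- by move=> k /suppF[/asboolPn nA /ABf[]].
Qed.

(** After division by monomials, [1 = f0 + f1] and [1 = g0 + g1] modulo [I], hence
    [1 = f0 + (1 - f0) g0 + f1 g1]; the product [f1 g0] is traded for [(1 - f0) g0], whose exponents
    stay in [A0]. *)
Lemma reducible_step P B A0 A1 m m' f0 f1 g0 g1 :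
  (forall a b, P a -> A0 b -> A0 (a + b)) -> P `<=` A0 ->
  (forall a b, B a -> A1 b -> A0 (a + b)) ->
  I ('X_[m] - (f0 + f1)) -> supp_in P m f0 -> supp_in B m f1 ->
  I ('X_[m'] - (g0 + g1)) -> supp_in A0 m' g0 -> supp_in A1 m' g1 ->
  reducible A0.
Proof.
move=> PA0 sPA BA1 If Pf0 Bf1 Ig Ag0 Ag1.
exists (m + m')%MM, ('X_[m] * g0 - f0 * g0 + f1 * g1 + f0 * 'X_[m']); split.
  pose a : {mpoly K[n]} := 'X_[m] - (f0 + f1).
  pose b : {mpoly K[n]} := 'X_[m'] - (g0 + g1).
  rewrite mpolyXD (_ : _ - _ = b * a + g1 * a + f1 * b); last by rewrite /a /b; ring.
  have [_ ID IM] := hI.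
  by apply: (ID); [apply: (ID)|]; apply: (IM).
apply: supp_inD; [apply: supp_inD; [apply: supp_inD|]|].
- by apply: supp_inM Ag0; [|exact: supp_in_X] => a b ->; rewrite add0r.
- by apply: supp_inN; apply: supp_inM Ag0; [|exact: Pf0].
- by apply: supp_inM Ag1; [|exact: Bf1].
- by apply: supp_inM Pf0 _; [|exact: supp_in_X] => a b /sPA + ->; rewrite addr0.
Qed.

(** Exponents of polynomials in [x^a] of degree at most [k] with coefficients supported in [P]. *)
Definition ladder P a k : set 'cV[int]_n :=
  [set x | exists2 p, P p & exists2 i, (i <= k)%N & x = p + a *+ i].

Definition ray P a : set 'cV[int]_n :=
  [set x | exists2 p, P p & exists i, x = p + a *+ i].

Lemma ladderD P a k : (forall p q, P p -> P q -> P (p + q)) ->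
  forall x y, P x -> ladder P a k y -> ladder P a k (x + y).
Proof.
move=> PD x _ Px [q Pq [i ik ->]].
by exists (x + q); [exact: PD | exists i; rewrite // addrA].
Qed.

Lemma sub_ladder P a k : P `<=` ladder P a k.
Proof. by move=> p Pp; exists p => //; exists 0%N; rewrite // mulr0n addr0. Qed.

Lemma ladder_split P a k f m : supp_in (ladder P a k.+1) m f ->
  exists f0 f1, [/\ f = f0 + f1, supp_in (ladder P a k) m f0 &
    supp_in [set x | exists2 p, P p & x = p + a *+ k.+1] m f1].
Proof.
move=> Pf; apply: supp_in_split => l /Pf[p Pp [i ik ->]].
by move: ik; rewrite leq_eqVlt => /predU1P[->|ik]; [right; exists p | left; exists p => //; exists i].
Qed.

Lemma reducible_ray P a : reducible (ray P a) ->
  ~ reducible P -> exists k, reducible (ladder P a k.+1) /\ ~ reducible (ladder P a k).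
Proof.
move=> [m [f [If Pf]]] redP.
have [k Pk] : exists k, supp_in (ladder P a k) m f.
  rewrite /supp_in in Pf *; elim: (msupp f) Pf => [|x s IH] Pf; first by exists 0%N.
  have [|k Pk] := IH; first by move=> y ys; apply: (Pf y); rewrite inE ys orbT.
  have [|p Pp [i xE]] := Pf x; first by rewrite inE eqxx.
  exists (maxn k i) => y; rewrite inE => /predU1P[->|/Pk[q Pq [j jk ->]]].
    by exists p => //; exists i; rewrite // leq_maxr.
  by exists q => //; exists j => //; rewrite (leq_trans jk) ?leq_maxl.
have red_ex : exists k, `[< reducible (ladder P a k) >].
  by exists k; apply/asboolP; exists m, f.
case: (ex_minnP red_ex) => -[|l] /asboolP redl minl.
  case: redP; have [m' [g [Ig Pg]]] := redl; exists m', g; split=> //.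
  by apply: supp_inS Pg => _ [p Pp [[|//] _ ->]]; rewrite mulr0n addr0.
exists l; split=> // redl'; have := minl l (asboolT redl').
by rewrite ltnn.
Qed.

(* Chevalley's argument for extending local rings to valuation rings: two
   relations of minimal degrees in x^a and x^-a can be combined into one of
   smaller degree. *)
Lemma ray_or_opp_ray P a : (forall p q, P p -> P q -> P (p + q)) ->
  ~ reducible P -> ~ reducible (ray P a) \/ ~ reducible (ray P (- a)).
Proof.
move=> PD redP; apply/not_andP => -[/reducible_ray/(_ redP)[k [redk redk']]].
move=> /reducible_ray/(_ redP)[l [redl redl']].
wlog : a k l redk redk' redl redl' / (l <= k)%N.
  move=> wlg; case/orP: (leq_total l k) => [|kl]; first exact: wlg redk redk' redl redl'.
  by apply: (wlg (- a) l k) => //; rewrite opprK.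
(* The top term, of degree [k.+1], times a term of degree [- j] with [0 < j <= l.+1], has degree in
   [[0, k]] because [l <= k]. *)
move=> lk; pose B := [set x | exists2 p, P p & exists2 j, (0 < j <= l.+1)%N & x = p - a *+ j].
have [m [f [If Pf]]] := redl.
have [f0 [f1 [fE Pf0 Bf1]]] : exists f0 f1, [/\ f = f0 + f1, supp_in P m f0 & supp_in B m f1].
  apply: supp_in_split => x /Pf[p Pp [[|j] jl ->]].
    by left; rewrite mulr0n addr0.
  by right; exists p => //; exists j.+1; rewrite // mulNrn.
have [m' [g [Ig /ladder_split[g0 [g1 [gE Ag0 Ag1]]]]]] := redk.
rewrite fE in If; rewrite gE in Ig.
apply: redk'; apply: (reducible_step _ _ _ If Pf0 Bf1 Ig Ag0 Ag1).
- exact: ladderD.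
- exact: sub_ladder.
- move=> _ _ [p Pp [j /andP[j0 jl] ->]] [q Pq ->].
  exists (p + q); [exact: PD | exists (k.+1 - j)%N; first by lia].
  by rewrite addrACA [- _ + _]addrC -mulrnBr // (leq_trans jl).
Qed.

(** In a relation of least degree in [x^-s], multiplying the top term by terms [x^(s + t)] lowers
    its degree by one, which contradicts minimality. *)
Lemma opp_ray P s : (forall p q, P p -> P q -> P (p + q)) ->
  (forall p, P p -> P (s + p)) -> ~ reducible P ->
  reducible (P `|` [set x | exists2 t, (forall p, P p -> P (t + p)) & x = s + t]) ->
  ~ reducible (ray P (- s)).
Proof.
move=> PD Ps redP [m [f [If /supp_in_split[f0 [f1 [fE Pf0 Bf1]]]]]].
move=> /reducible_ray/(_ redP)[l [redl]]; apply.
have [m' [g [Ig /ladder_split[g0 [g1 [gE Ag0 Ag1]]]]]] := redl.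
rewrite fE in If; rewrite gE in Ig.
apply: (reducible_step _ _ _ If Pf0 Bf1 Ig Ag0 Ag1).
- exact: ladderD.
- exact: sub_ladder.
- move=> _ _ [t Pt ->] [p Pp ->]; exists (t + p); first exact: Pt.
  by exists l => //; rewrite mulrS [s + t]addrC -addrA (addrCA s p) addNKr addrA.
Qed.

(* P is the set of exponents > 0 and E the set of exponents equivalent to 0. *)
Record total_preorder P E : Prop := TotalPreorder {
  posD : forall a b, P a -> P b -> P (a + b);
  equivD : forall a b, E a -> E b -> E (a + b);
  equivN : forall a, E a -> E (- a);
  equiv_posD : forall a b, E a -> P b -> P (a + b);
  equiv0 : E 0;
  pos0 : ~ P 0;
  trichotomy : forall a, [\/ P a, E a | P (- a)] }.

Lemma irreducible_pos0 P : ~ reducible P -> ~ P 0.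
Proof.
move=> redP P0; apply: redP; exists 0%MM, 'X_[0%MM]; split.
  by rewrite subrr; case: hI.
by apply: supp_inS (@supp_in_X _) => _ ->.
Qed.

(** [P] is maximal by Zorn's lemma, and [E] consists of the invertible elements of the monoid [S] of
    translations preserving [P]. Maximality turns [ray_or_opp_ray] into [S a] or [S (- a)], and
    [opp_ray] into invertibility of the elements of [S] outside [P]. *)
Lemma maximal_preorder P0 (U : set 'cV[int]_n) : (forall u, U u -> U (- u)) ->
  (forall a b, P0 a -> P0 b -> P0 (a + b)) ->
  (forall u a, U u -> P0 a -> P0 (u + a)) -> ~ reducible P0 ->
  exists P E, [/\ P0 `<=` P, U `<=` E, ~ reducible P & total_preorder P E].
Proof.
move=> UN P0D UP0 redP0.
pose cond Q := [/\ forall a b, Q a -> Q b -> Q (a + b),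
  forall u a, U u -> Q a -> Q (u + a) & ~ reducible Q].
pose J A := cond (A `|` P0).
have [F FJ Ftot|A [JA maxA]] := @Zorn_bigcup _ J.
  have [[A0 FA0]|F0] := pselect (exists A, F A); last first.
    rewrite /J; suff -> : (\bigcup_(X in F) X) `|` P0 = P0 by [].
    by apply/seteqP; split=> f; [case=> // -[A FA]; case: F0; exists A | right].
  have UE (f : 'cV_n) : ((\bigcup_(X in F) X) `|` P0) f <-> exists2 A, F A & (A `|` P0) f.
    split=> [[[A FA Af]|If]|[A FA [Af|If]]]; [by exists A => //; left|
      by exists A0 => //; right|by left; exists A|by right].
  have joint A B : F A -> F B -> exists2 C, F C & A `<=` C /\ B `<=` C.
    by move=> FA FB; case: (Ftot A B FA FB) => AB; [exists B|exists A] => //; split.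
  split.
  - move=> a b /UE[A FA Aa] /UE[B FB Bb]; apply/UE.
    have [C FC [AC BC]] := joint A B FA FB; exists C => //.
    by have [CD _ _] := FJ C FC; apply: CD; [case: Aa | case: Bb]; try (by right); left; auto.
  - move=> u a Uu /UE[A FA Aa]; apply/UE; exists A => //.
    by have [_ AU _] := FJ A FA; apply: AU.
  - move=> [m [f [If Uf]]].
    (* A relation has finitely many exponents, so it already lives in one member of the chain. *)
    have [A FA Af] : exists2 A, F A & supp_in (A `|` P0) m f.
      rewrite /supp_in in Uf *; elim: (msupp f) Uf => [|x s IH] Uf; first by exists A0.
      have [|A FA As] := IH; first by move=> y ys; apply: (Uf y); rewrite inE ys orbT.
      have /UE[B FB Bx] := Uf x (mem_head _ _).
      have [C FC [AC BC]] := joint A B FA FB; exists C => // y.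
      rewrite inE => /predU1P[->|/As]; first by case: Bx; [left; apply: BC|right].
      by case; [left; apply: AC|right].
    by have [_ _] := FJ A FA; apply; exists m, f.
set P := A `|` P0 in JA *; have [PD UP redP] := JA.
have PmaxP Q : P `<=` Q -> cond Q -> Q `<=` P.
  move=> PQ cQ; apply: contrapT => QP; apply: (maxA Q).
    split; first by move=> a Aa; apply: PQ; left.
    by apply: contra_not QP => QA a /QA; left.
  suff QE : Q `|` P0 = Q by rewrite /J QE.
  by apply/seteqP; split=> a; [case=> // P0a; apply: PQ; right | left].
pose S a := forall p, P p -> P (a + p).
have ray_cond a : ~ reducible (ray P a) -> S a.
  move=> reda; have : ray P a `<=` P.
    apply: PmaxP; first by move=> p Pp; exists p => //; exists 0%N; rewrite mulr0n addr0.
    split=> //.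
    - move=> _ _ [p Pp [i ->]] [q Pq [j ->]]; exists (p + q); first exact: PD.
      by exists (i + j)%N; rewrite mulrnDr addrACA.
    - move=> u _ Uu [p Pp [i ->]]; exists (u + p); first exact: UP.
      by exists i; rewrite addrA.
  by move=> sub p Pp; apply: sub; exists p => //; exists 1%N; rewrite mulr1n addrC.
have SN a : S a \/ S (- a) by case: (ray_or_opp_ray a PD redP) => /ray_cond; [left|right].
have SD a b : S a -> S b -> S (a + b) by move=> Sa Sb p /Sb/Sa; rewrite addrA.
have SPN s : S s -> ~ P s -> S (- s).
  move=> Ss nPs; apply: ray_cond; apply: opp_ray => //.
  (* Were the enlargement by [s + S] irreducible, maximality would put [s] in [P]. *)
  apply: contrapT => redQ; apply: nPs.
  suff : P `|` [set x | exists2 t, S t & x = s + t] `<=` P.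
    by apply; right; exists 0; rewrite ?addr0 // => p; rewrite add0r.
  apply: PmaxP; first by left.
  split=> //.
  - move=> a b [Pa|[t St ->]] [Pb|[r Sr ->]]; first by left; exact: PD.
    + by left; rewrite addrC -addrA; apply/Ss/Sr.
    + by left; rewrite -addrA; apply/Ss/St.
    + right; exists (t + (s + r)); last by rewrite -addrA.
      by apply: (SD) => //; apply: SD.
  - move=> u a Uu [Pa|[t St ->]]; first by left; exact: UP.
    right; exists (u + t); last by rewrite addrCA.
    by apply: SD => // p; exact: UP.
pose E a := S a /\ S (- a).
exists P, E; split=> //; first by right.
  by move=> u Uu; split=> p; apply: UP => //; exact: UN.
split=> //.
- by move=> a b [Sa SNa] [Sb SNb]; split; [exact: SD | rewrite opprD; exact: SD].
- by move=> a [Sa SNa]; split; rewrite ?opprK.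
- by move=> a b [Sa _]; exact: Sa.
- by split=> p; rewrite ?oppr0 add0r.
- exact: irreducible_pos0.
- move=> a; have [Pa|nPa] := pselect (P a); first by constructor 1.
  have [PNa|nPNa] := pselect (P (- a)); first by constructor 3.
  constructor 2; case: (SN a) => Sa; split=> //; first exact: SPN.
  by rewrite -[a]opprK; exact: SPN.
Qed.

End Preorders.

(** * Dickson's lemma and standard bases for a preorder *)

(** Induction on the set [D] of coordinates that may vary. Fix [a] in [A]: any [y] not above it has
    a coordinate smaller than that of [a], so it lies in one of finitely many slices where one more
    coordinate is constant. *)
Lemma dickson (T : finType) (X : eqType) (v : X -> T -> nat) (A : set X) :
  exists s : seq X, (forall x, x \in s -> A x) /\
    forall y, A y -> exists2 x, x \in s & forall t, (v x t <= v y t)%N.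
Proof.
suff H N (D : {set T}) (B : set X) : (#|D| < N)%N ->
    (forall x y t, B x -> B y -> t \notin D -> v x t = v y t) ->
    exists s : seq X, (forall x, x \in s -> B x) /\
    forall y, B y -> exists2 x, x \in s & forall t, (v x t <= v y t)%N.
  by apply: (H #|[set: T]%SET|.+1 [set: T]%SET) => // x y t; rewrite inE.
elim: N D B => // N IH D B; rewrite ltnS => DN BD.
have [[a Ba]|nB] := pselect (exists a, B a); last first.
  by exists [::]; split=> // y By; case: nB; exists y.
have slice (tc : T * nat) : exists s : seq X, tc.1 \in D ->
    (forall x, x \in s -> B x) /\
    forall y, B y -> v y tc.1 = tc.2 -> exists2 x, x \in s & forall t, (v x t <= v y t)%N.
  case: tc => t c /=; have [tD|tD] := boolP (t \in D); last by exists [::].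
  have [||s [sB sP]] := IH (D :\ t) [set y | B y /\ v y t = c].
  - by apply: leq_trans DN; rewrite [X in (_ < X)%N](cardsD1 t) tD add1n ltnS.
  - move=> x y t' [Bx xc] [By yc]; rewrite !inE negb_and negbK => /orP[/eqP->|t'D].
      by rewrite xc yc.
    exact: BD.
  by exists s => _; split=> [x /sB[]//|y By yc]; apply: sP.
have [S SP] := choice slice.
exists (a :: flatten [seq flatten [seq S (t, c) | c <- iota 0 (v a t)] | t <- enum D]).
split=> [x|y By].
  rewrite inE => /predU1P[->//|/flatten_mapP[t]]; rewrite mem_enum => tD.
  by move=> /flatten_mapP[c _]; have [+ _] := SP (t, c) tD; apply.
have [/forallP ay|] := boolP [forall t, (v a t <= v y t)%N].
  by exists a; rewrite ?inE ?eqxx.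
move=> /forallPn[t]; rewrite -ltnNge => yat.
have tD : t \in D by apply: contraLR yat => /(BD _ _ _ Ba By) ->; rewrite ltnn.
have [_ /(_ y By erefl)[x xS xP]] := SP (t, v y t) tD.
exists x => //; rewrite inE; apply/orP; right.
apply/flatten_mapP; exists t; rewrite ?mem_enum //.
by apply/flatten_mapP; exists (v y t); rewrite ?mem_iota.
Qed.

Section PreorderInitial.
Variables (K : fieldType) (n : nat) (I : set {mpoly K[n]}).
Hypothesis hI : is_ideal I.
Variables P E : set 'cV[int]_n.
Hypotheses (hPE : total_preorder P E) (redP : ~ reducible I P).
Implicit Types (f g h : {mpoly K[n]}) (m k : 'X_{1..n}).

(** Breaking ties by the monomial order gives a strict total order compatible with
    multiplication. *)
Definition pre_lt m k :=
  P (mnmz k - mnmz m) \/ E (mnmz k - mnmz m) /\ (m < k)%O.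

Lemma pre_lt_trans m k l : pre_lt m k -> pre_lt k l -> pre_lt m l.
Proof.
rewrite /pre_lt -(subrKA (mnmz k) (mnmz l) (- mnmz m)).
move=> [Pmk|[Emk mk]] [Pkl|[Ekl kl]].
- by left; apply: (posD hPE).
- by left; apply: (equiv_posD hPE).
- by left; rewrite addrC; apply: (equiv_posD hPE).
- by right; split; [apply: (equivD hPE) | exact: lt_trans kl].
Qed.

Lemma pre_lt_irr m : ~ pre_lt m m.
Proof. by case=> [|[_]]; rewrite ?subrr ?ltxx //; exact: (pos0 hPE). Qed.

Lemma pre_lt_total m k : m != k -> pre_lt m k \/ pre_lt k m.
Proof.
move=> mk; case: (trichotomy hPE (mnmz k - mnmz m)) => [Pmk|Emk|Pkm].
- by left; left.
- case: (ltgtP m k) mk => // mk _; first by left; right.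
  by right; right; split=> //; rewrite -opprB; exact: (equivN hPE).
- by right; left; rewrite -opprB.
Qed.

Lemma pre_ltD m k l : pre_lt m k -> pre_lt (m + l)%MM (k + l)%MM.
Proof. by rewrite /pre_lt !mnmzD opprD addrACA subrr addr0 ltmc_add2l. Qed.

Lemma pre_lt_min (s : seq 'X_{1..n}) : s != [::] ->
  exists2 m, m \in s & forall k, k \in s -> k != m -> pre_lt m k.
Proof.
elim: s => // x s IH _; have [->|/IH[m ms mP]] := eqVneq s [::].
  by exists x; rewrite ?mem_head // => k; rewrite inE => ->.
have [<-|xm] := eqVneq m x.
  exists m; rewrite ?mem_head // => k; rewrite inE => /predU1P[->|]; first by rewrite eqxx.
  exact: mP.
have [mx|xm'] := pre_lt_total xm.
  exists m; first by rewrite inE ms orbT.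
  by move=> k; rewrite inE => /predU1P[->//|]; exact: mP.
exists x; first exact: mem_head.
move=> k; rewrite inE => /predU1P[->|ks _]; first by rewrite eqxx.
have [->//|km] := eqVneq k m.
exact: pre_lt_trans (mP k ks km).
Qed.

Definition pre_lead f m :=
  f@_m != 0 /\ forall k, k \in msupp f -> k != m -> pre_lt m k.

(** The size bound is kept with the leading exponent: [pre_lt] need not be a well-order, and
    reduction ends because it stays among finitely many monomials. *)
Definition lead_set (x : 'X_{1..n} * nat) f :=
  [/\ I f, (msize f <= x.2)%N & pre_lead f x.1].

Lemma msize_leqP d f : reflect (forall k, k \in msupp f -> (mdeg k < d)%N) (msize f <= d)%N.
Proof.
apply: (iffP idP) => [fd k /msize_mdeg_lt kf|fd]; first exact: leq_trans kf fd.
by rewrite msizeE; apply/bigmax_leqP_seq => k kf _; apply: fd.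
Qed.

(* The family b of the proof is a standard basis of I, in each degree, for the
   order given by (P, E), and w is compatible with (P, E) on its supports. If f in
   I had a single w-initial term, reducing its other terms by b would give a
   (P, E)-initial monomial. *)
Lemma preorder_tropical (R : realType) : exists F : seq 'cV[int]_n,
  (forall a, a \in F -> P a) /\
  forall w : 'cV[R]_n, (forall a, a \in F -> 0 <= dotv w (Defs.realmx R a)) ->
    (forall e, E e -> dotv w (Defs.realmx R e) = 0) -> tropical_variety R I w.
Proof.
(* Besides exponents, the room left below the size bound is compared, so that the multiple of a
   basis element with leading exponent [k] respects the bound [d]. *)
pose v (x : 'X_{1..n} * nat) (t : option 'I_n) :=
  if t is Some i then x.1 i else (x.2 - mdeg x.1)%N.
have [s [sL sP]] := dickson v [set x | exists f, lead_set x f].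
have pick_f x : exists f, x \in s -> lead_set x f.
  by have [/sL[f]|_] := boolP (x \in s); [exists f|exists 0].
have [b bP] := choice pick_f.
exists [seq a <- flatten [seq [seq mnmz k - mnmz x.1 | k <- msupp (b x)] | x <- s] | `[<P a>]].
split=> [a|w wP wE]; first by rewrite mem_filter => /andP[/asboolP].
apply/tropical_varietyP => // f m If [fm fmin].
have wdotB_mnmz k l : wdot w k - wdot w l = dotv w (Defs.realmx R (mnmz k - mnmz l)).
  rewrite !wdotE /dotv -sumrB; apply: eq_bigr => i _.
  by rewrite !mxE -mulrBr -intrB.
have wb x k : x \in s -> k \in msupp (b x) -> wdot w x.1 <= wdot w k.
  move=> xs kb; rewrite -subr_ge0 wdotB_mnmz.
  have [->|kx] := eqVneq k x.1; first by rewrite subrr (wE 0) //; exact: (equiv0 hPE).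
  have [_ _ [_ /(_ k kb kx)[Pk|[Ek _]]]] := bP x xs; last by rewrite wE.
  apply: wP; rewrite mem_filter; apply/andP; split; first exact/asboolP.
  by apply/flatten_mapP; exists x => //; apply/mapP; exists k.
pose d := msize f.
pose good g := [/\ I g, (msize g <= d)%N & initial_monomial w g m].
(* These are the terms that the basis can cancel within the size bound. *)
pose bad g k := [/\ k \in msupp g, k != m & exists h, lead_set (k, d) h].
have step g k : good g -> bad g k -> (forall l, bad g l -> l != k -> pre_lt k l) ->
    exists2 g', good g' & forall l, bad g' l -> pre_lt k l.
  move=> [Ig gd [gm gmin]] [kg km [h0 Lh0]] kmin.
  have [x xs xk] := sP (k, d) (ex_intro _ h0 Lh0).
  have xk1 : (x.1 <= k)%MM by apply/mnm_lepP => i; exact: (xk (Some i)).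
  have [Ib bd [bx bmin]] := bP x xs.
  pose h := b x * 'X_[k - x.1].
  have hE l : h@_l = if (k - x.1 <= l)%MM then (b x)@_(l - (k - x.1)) else 0 by rewrite mcoeffMXE.
  have hsupp l : l \in msupp h -> exists2 l', l' \in msupp (b x) & l = (l' + (k - x.1))%MM.
    rewrite mcoeff_msupp hE; case: ifP => [lk|]; last by rewrite eqxx.
    by rewrite -mcoeff_msupp => lb; exists (l - (k - x.1))%MM; rewrite // submK.
  have kE : (x.1 + (k - x.1) = k)%MM by rewrite addmC submK.
  have hk : h@_k != 0 by rewrite -[X in h@_X]kE /h addmC mcoeffMX.
  have hlt l : l \in msupp h -> l != k -> pre_lt k l.
    move=> /hsupp[l' l'b ->]; rewrite -[X in _ != X]kE eqm_add2r => l'x.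
    by rewrite -[X in pre_lt X]kE; apply: pre_ltD; apply: bmin.
  have kd : (mdeg k < d)%N by move/msize_leqP: gd; apply.
  have hd : (msize h <= d)%N.
    apply/msize_leqP => _ /hsupp[l lb ->].
    have := xk None; rewrite /= mdegD => xkd.
    have ld : (mdeg l < x.2)%N by move/msize_leqP: bd; apply.
    have xd : (mdeg x.1 < x.2)%N.
      by move/msize_leqP: bd; apply; rewrite mcoeff_msupp.
    have arith (a1 a2 a3 a4 a5 a6 : nat) : (a4 < a5 -> a2 < a5 -> a3 < a6 ->
        a5 - a4 <= a6 - a3 -> a4 + a1 = a3 -> a2 + a1 < a6)%N by lia.
    apply: (arith _ _ _ _ _ _ xd ld kd xkd).
    by rewrite -[in RHS]kE mdegD.
  (* The leading term of a basis element has least [w]-weight, so the terms of [h] weigh at least as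
     much as [k], hence more than [m], and [m] stays initial. *)
  have wh l : l \in msupp h -> wdot w m < wdot w l.
    move=> /hsupp[l' l'b ->]; apply: lt_le_trans (gmin k kg km) _.
    by rewrite -[X in wdot w X <= _]kE !wdotD lerD2r; exact: wb.
  have hm : h@_m = 0 by apply: memN_msupp_eq0; apply/negP => /wh; rewrite ltxx.
  pose g' := g - (g@_k / h@_k) *: h.
  have g'supp l : l \in msupp g' -> l \in msupp g \/ l \in msupp h.
    by move=> /msuppB_le; rewrite mem_cat => /orP[|/msuppZ_le]; [left|right].
  have g'k : g'@_k = 0 by rewrite mcoeffB mcoeffZ divfK // subrr.
  exists g'.
    split.
    - by apply: (idealB hI) => //; apply: (idealZ _ hI); rewrite /h mulrC; case: hI => _ _; apply.
    - apply/msize_leqP => l /g'supp[]; first by move/msize_leqP: gd; apply.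
      by move/msize_leqP: hd; apply.
    - split; first by rewrite mcoeffB mcoeffZ hm mulr0 subr0.
      by move=> l /g'supp[/gmin//|/wh].
  move=> l [lg' lm Ll]; have lk : l != k.
    by apply: contraTneq lg' => ->; rewrite mcoeff_msupp g'k eqxx.
  by have [lg|lh] := g'supp l lg'; [apply: kmin | apply: hlt].
have [g [Ig gd [gm gmin]] gbad] : exists2 g, good g & forall k, ~ bad g k.
  (* This finite set shrinks: cancelling the least bad exponent leaves only larger bad ones. *)
  pose up g := [set u : 'X_{1..n < d} | `[< exists2 k, bad g k & k = u \/ pre_lt k u >]]%SET.
  have : good f by split.
  have [N] := ubnP #|up f|; elim: N (f) => // N IH g; rewrite ltnS => gN gg.
  have [[k0 badk0]|nb] := pselect (exists k, bad g k); last first.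
    by exists g => // k bk; apply: nb; exists k.
  have [|k] := @pre_lt_min [seq k <- msupp g | `[<bad g k>]].
    apply/eqP => s0; have : k0 \in [seq k <- msupp g | `[<bad g k>]].
      by rewrite mem_filter; apply/andP; split; [exact/asboolP | case: badk0].
    by rewrite s0.
  rewrite mem_filter => /andP[/asboolP bk kg] kmin.
  have [|g' gg' g'lt] := step g k gg bk.
    by move=> l bl; apply: kmin; rewrite mem_filter; apply/andP; split; [exact/asboolP|case: bl].
  apply: (IH g') => //; apply: leq_trans gN; apply: proper_card.
  have kd : (mdeg k < d)%N by case: gg => _ /msize_leqP gd _; apply: gd.
  apply/properP; split; last first.
    exists (BMultinom kd); rewrite /up inE; first by apply/asboolP; exists k => //; left.
    apply/asboolP => -[l /g'lt kl [lk|lk]]; first by move: kl; rewrite lk; apply: pre_lt_irr.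
    exact: (pre_lt_irr (pre_lt_trans kl lk)).
  apply/fintype.subsetP => u; rewrite inE => /asboolP[l /g'lt kl lu]; rewrite inE; apply/asboolP.
  by exists k => //; right; case: lu => [<-//|]; exact: pre_lt_trans.
have g0 : msupp g != [::].
  by rewrite msupp_eq0; apply: contraNneq gm => ->; rewrite mcoeff0.
have [k kg kmin] := pre_lt_min g0.
(* Since [g] itself leads at [k], a [k] other than [m] would be bad. The remaining exponents differ
   from [m] by elements of [P], as a difference in [E] would mean equal weight; so [P] would be
   reducible. *)
have km : k = m.
  apply/eqP/negPn/negP => km; apply: (gbad k); split=> //; exists g; split=> //.
  by split=> //; rewrite -mcoeff_msupp.
apply: redP; exists m, ('X_[m] - (g@_m)^-1 *: g); split.
  by rewrite subKr; apply: idealZ.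
move=> l; rewrite mcoeff_msupp mcoeffB mcoeffX mcoeffZ.
have [<-|ml] := eqVneq m l; first by rewrite mulVf // subrr eqxx.
rewrite sub0r oppr_eq0 mulf_eq0 negb_or -mcoeff_msupp => /andP[_ lg].
rewrite eq_sym in ml; have := kmin l lg; rewrite km => /(_ ml)[//|[El _]].
by have := gmin l lg ml; rewrite -subr_gt0 wdotB_mnmz wE // ltxx.
Qed.
End PreorderInitial.

(** * Principal open subsets of charts are open in the toric variety *)

Section ChartOpen.
Variables (R : realType) (K : closedFieldType) (n : nat).
Variable Sigma : set (set 'cV[R]_n).
Implicit Types (M N : chart Sigma) (u v : 'cV[K]_n) (g : {mpoly K[n]}).

Lemma chart_incl_glue M N u v :
  chart_incl M u = chart_incl N v :> toric_variety K Sigma <->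
  biregular_sends (transition_mx M N) u v.
Proof.
split=> [/eqP|uv]; last by apply/eqP; rewrite /chart_incl eqmodE; apply/asboolP.
by rewrite /chart_incl eqmodE => /asboolP.
Qed.

(* Over an open set where the transition map and its inverse are given by
   fractions with nonvanishing denominators, gluing is the graph of the former. *)
Lemma toric_closed_compl M g :
  toric_closed (~` (chart_incl M @` [set v | peval g v != 0]) : set (toric_variety K Sigma)).
Proof.
move=> N; pose A v := exists2 u, biregular_sends (transition_mx N M) v u & peval g u != 0.
exists [set h | forall v, ~ A v -> peval h v = 0].
have imA v : (chart_incl M @` [set v | peval g v != 0] : set (toric_variety K Sigma))
    (chart_incl N v) <-> A v.
  split=> [[u gu /esym/chart_incl_glue uv]|[u uv gu]]; first by exists u.
  by exists u => //; apply/esym/chart_incl_glue.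
apply/seteqP; split=> [v Zv h hA|v0 hv0 /imA[u0]].
  by apply: hA => /imA.
set T := transition_mx N M.
have uT : T \in unitmx by exact: transition_mx_unit.
move=> [fwd bwd] gu0.
have [p /choice[q pq]] := choice fwd; have [p' /choice[q' pq']] := choice bwd.
(* [G] adds to [g] the denominators of the inverse map, and [H] is the pull-back of [G] with
   denominators cleared. Then [H * D] vanishes off [A] but not at [v0]. *)
pose G := g * \prod_i q' i; pose D := \prod_i q i.
have [H HE] := @peval_frac _ _ p q G (msize G) (leqnn _).
have DE z : peval D z = \prod_i peval (q i) z by rewrite /peval rmorph_prod.
have GE z : peval G z = peval g z * \prod_i peval (q' i) z.
  by rewrite /peval mevalM rmorph_prod.
have u0E : u0 = \col_i (peval (p i) v0 / peval (q i) v0).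
  by apply/colP => i; rewrite mxE; have [] := pq i.
have qv0 i : peval (q i) v0 != 0 by have [] := pq i.
suff : peval (H * D) v0 = 0.
  apply/eqP; rewrite /peval mevalM mulf_neq0 //; last first.
    by rewrite -/(peval D v0) DE; apply/prodf_neq0 => i _.
  rewrite -/(peval H v0) HE // -u0E mulf_neq0 //.
    rewrite GE mulf_neq0 //; apply/prodf_neq0 => i _.
    by have [] := pq' i.
  by apply/prodf_neq0 => i _; rewrite expf_neq0.
apply: hv0 => v nAv; apply/eqP; apply: contra_notT nAv.
rewrite /peval mevalM mulf_eq0 negb_or -/(peval H v) -/(peval D v) => /andP[Hv].
rewrite DE => /prodf_neq0 qv.
have {}qv i : peval (q i) v != 0 by exact: qv.
pose u := \col_i (peval (p i) v / peval (q i) v).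
move: Hv; rewrite HE // mulf_eq0 negb_or => /andP[Gu _].
move: Gu; rewrite GE mulf_eq0 negb_or => /andP[gu /prodf_neq0 q'u].
exists u => //.
have Tvu : regular_sends (monomial_map T) v u.
  move=> j; exists (p j), (q j); have [_ qf _] := pq j; split=> //.
  by rewrite mxE.
split=> //; pose v' := \col_i (peval (p' i) u / peval (q' i) u).
have Tuv' : regular_sends (monomial_map (invmx T)) u v'.
  move=> j; exists (p' j), (q' j); have [_ qf _] := pq' j; split=> //; first exact: q'u.
  by rewrite mxE.
(* The composite is the identity on the torus, and values of a regular map are unique. *)
suff -> : v = v' by [].
apply: regular_sends_fun (regular_sends1 v) _.
by rewrite -(mulmxV uT); apply: regular_sends_comp Tuv'.
Qed.
End ChartOpen.

(** * Monomial substitutions with integer exponents *)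

Section LaurentSubstitution.
Variables (K : fieldType) (n : nat).
Implicit Types (g : {mpoly K[n]}) (B : 'M[int]_n) (a l : 'cV[int]_n).

Definition mnm_of_vec a : 'X_{1..n} := [multinom absz (a i ord0) | i < n].

Lemma mnm_of_vecK a : (forall i, 0 <= a i 0) -> mnmz (mnm_of_vec a) = a.
Proof. by move=> a0; apply/colP => i; rewrite mxE mnmE gez0_abs. Qed.

(* Up to the factor x^l, the substitution y_j = x^(col j B); meaningful when no
   negative exponent remains. *)
Definition laurent_subst B l g : {mpoly K[n]} :=
  \sum_(k <- msupp g) g@_k *: 'X_[mnm_of_vec (B *m mnmz k + l)].

Lemma msupp_laurent_subst B l g m :
  (forall k, k \in msupp g -> forall i, 0 <= (B *m mnmz k + l) i 0) ->
  m \in msupp (laurent_subst B l g) ->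
  exists2 k, k \in msupp g & mnmz m = B *m mnmz k + l.
Proof.
move=> ge0 /(@msupp_sum_le _ _ _ _ _ _ _); rewrite filter_predT => /flatten_mapP[k kg].
by move=> /msuppZ_le/mem_msuppXP <-; exists k; rewrite // mnm_of_vecK //; exact: ge0.
Qed.

Lemma mcoeff_laurent_subst B l g m k0 :
  (forall k, k \in msupp g -> forall i, 0 <= (B *m mnmz k + l) i 0) ->
  k0 \in msupp g -> mnmz m = B *m mnmz k0 + l ->
  (forall k, k \in msupp g -> B *m mnmz k + l = mnmz m -> k = k0) ->
  (laurent_subst B l g)@_m = g@_k0.
Proof.
move=> ge0 k0g mE inj; rewrite /laurent_subst raddf_sum /=.
rewrite (bigD1_seq k0) ?msupp_uniq //= big1_seq => [|k /andP[kk0 kg]].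
  rewrite addr0 mcoeffZ mcoeffX -mE (_ : mnm_of_vec _ = m) ?eqxx ?mulr1 //.
  by apply: mnmz_inj; rewrite mnm_of_vecK // mE; exact: ge0.
rewrite mcoeffZ mcoeffX; case: eqP => [km|_]; last by rewrite mulr0.
case/eqP: kk0; apply: inj => //.
by rewrite -km mnm_of_vecK //; exact: ge0.
Qed.
End LaurentSubstitution.

Section LaurentEval.
Variables (K : closedFieldType) (n : nat).
Implicit Types (g : {mpoly K[n]}) (B : 'M[int]_n) (a l : 'cV[int]_n) (z : 'cV[K]_n).

Definition monomial_value a z : K := \prod_i z i 0 ^ a i 0.

Lemma monomial_valueD a l z : torus z ->
  monomial_value (a + l) z = monomial_value a z * monomial_value l z.
Proof.
move=> tz; rewrite /monomial_value -big_split; apply: eq_bigr => i _.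
by rewrite mxE expfzDr.
Qed.

Lemma monomial_value_mul B a z : torus z ->
  monomial_value a (monomial_map B z) = monomial_value (B *m a) z.
Proof.
move=> tz; rewrite /monomial_value.
transitivity (\prod_i \prod_j z j 0 ^ (B j i * a i 0)).
  apply: eq_bigr => i _; rewrite mxE.
  rewrite (big_morph (fun x : K => x ^ a i 0) (id1 := 1) (op1 := *%R)).
  - by apply: eq_bigr => j _; rewrite exprz_exp.
  - by move=> x y; exact: expfzMl.
  - exact: exp1rz.
rewrite exchange_big; apply: eq_bigr => j _ /=; rewrite mxE.
rewrite (big_morph (fun x : int => z j 0 ^ x) (id1 := 1) (op1 := *%R)) //.
by move=> x y; rewrite expfzDr ?tz.
Qed.

Lemma pevalX m z : peval 'X_[m] z = monomial_value (mnmz m) z.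
Proof. by rewrite /peval mevalX; apply: eq_bigr => i _; rewrite mxE. Qed.

Lemma peval_sum g z : peval g z = \sum_(k <- msupp g) g@_k * monomial_value (mnmz k) z.
Proof.
by rewrite /peval mevalE; apply: eq_bigr => k _; rewrite -pevalX /peval mevalX.
Qed.

Lemma peval_laurent_subst B l g z : torus z ->
  (forall k, k \in msupp g -> forall i, 0 <= (B *m mnmz k + l) i 0) ->
  peval (laurent_subst B l g) z = monomial_value l z * peval g (monomial_map B z).
Proof.
move=> tz ge0; rewrite /laurent_subst {1}/peval (raddf_sum (meval _)) /=.
rewrite peval_sum mulr_sumr big_seq [RHS]big_seq; apply: eq_bigr => k kg.
rewrite mevalZ -/(peval 'X_[_] z) pevalX mnm_of_vecK; last exact: ge0.
by rewrite monomial_valueD // monomial_value_mul // mulrA mulrC.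
Qed.
End LaurentEval.

(** * Reducibility keeps the strict transform away from the orbit *)

Section MissedOrbit.
Variables (R : realType) (K : closedFieldType) (n : nat).
Implicit Types (M : 'M[int]_n) (J : {set 'I_n}) (I : set {mpoly K[n]}).

(* In the chart coordinates y, the exponents of the monomials in the ideal
   generated by the y_i, i in J, in the ring K[y] with the other y_i inverted. *)
Definition face_pos M J : set 'cV[int]_n :=
  [set a | (forall i, i \in J -> 0 <= (M^T *m a) i 0) /\
           exists2 i, i \in J & 0 < (M^T *m a) i 0].

Lemma chart_mx_ge0 (Sigma : set (set 'cV[R]_n)) (M : chart Sigma) i j :
  fan_support Sigma = orthant R n -> 0 <= val M i j.
Proof.
move=> suppS; have /andP[_ /asboolP SM] := valP M.
have : orthant R n (col j (Defs.realmx R (val M))).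
  by rewrite -suppS; exists (cone (Defs.realmx R (val M))); last exact: cone_col.
by move=> /(_ i); rewrite !mxE ler0z.
Qed.

(** A zero coordinate [z i] kills each coordinate of the image with nonzero exponent in it, and an
    invertible matrix has no zero row. *)
Lemma torus_of_monomial_map M (z : 'cV[K]_n) : M \in unitmx -> (forall i j, 0 <= M i j) ->
  torus (monomial_map M z) -> torus z.
Proof.
move=> uM M0 tz i; apply/negP => /eqP zi.
have [j Mij] : exists j, M i j != 0.
  apply/existsP; apply: contraLR uM => /existsPn Mi0.
  apply/negP => uM; have := oner_neq0 int; rewrite -[1](_ : (1%:M : 'M[int]_n) i i = 1).
    rewrite -(mulmxV uM) mxE big1 ?eqxx // => j _.
    by have /negPn/eqP -> := Mi0 j; rewrite mul0r.
  by rewrite mxE eqxx.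
have := tz j; rewrite mxE (bigD1 i) //= zi.
by rewrite exp0rz (negPf Mij) mul0r eqxx.
Qed.

Lemma torusP (z : 'cV[K]_n) :
  ~ zero_set [set \prod_(i < n) 'X_i : {mpoly K[n]}] z <-> torus z.
Proof.
have prodE : peval (\prod_(i < n) 'X_i : {mpoly K[n]}) z = \prod_i z i 0.
  by rewrite /peval rmorph_prod; apply: eq_bigr => i _; rewrite /= mevalXU.
split=> [nz i|tz /(_ _ erefl)]; last first.
  by rewrite prodE; apply/eqP/prodf_neq0 => i _.
apply/negP => /eqP zi; apply: nz => _ ->.
by rewrite prodE (bigD1 i) //= zi mul0r.
Qed.

(** In the chart the relation becomes a polynomial [g] that vanishes on the torus part of the
    preimage of V(I) but not at [u]; the locus where [g] is nonzero is an open neighbourhood of the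
    point. *)
Lemma reducible_missed (Sigma : set (set 'cV[R]_n)) (M : chart Sigma) J I (u : 'cV[K]_n) :
  fan_support Sigma = orthant R n -> (forall i, u i 0 = 0 <-> i \in J) ->
  reducible I (face_pos (val M) J) ->
  ~ strict_transform Sigma (zero_set I) (chart_incl M u).
Proof.
move=> suppS uJ [m [f [If Pf]]].
have M0 i j : 0 <= (val M)^T i j by rewrite mxE; exact: chart_mx_ge0.
have MX k i : 0 <= ((val M)^T *m mnmz k) i 0.
  by rewrite mxE; apply: sumr_ge0 => j _; rewrite mulr_ge0 // mxE.
(* Only exponents with index in [J] are lowered: those of [x^m] become 0, while each term of [f]
   keeps a positive one and so vanishes at [u]. *)
pose l : 'cV[int]_n := \col_i (if i \in J then - ((val M)^T *m mnmz m) i 0 else 0).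
have lE i : l i 0 = if i \in J then - ((val M)^T *m mnmz m) i 0 else 0 by rewrite mxE.
have lf k : k \in msupp f -> forall i, 0 <= ((val M)^T *m mnmz k + l) i 0.
  move=> kf i; rewrite mxE lE; case: ifP => iJ; last by rewrite addr0.
  by have [/(_ i iJ) + _] := Pf k kf; rewrite mulmxBr !mxE.
have lm k : k \in msupp ('X_[m] : {mpoly K[n]}) -> forall i, 0 <= ((val M)^T *m mnmz k + l) i 0.
  move=> /mem_msuppXP <- i; rewrite mxE lE; case: ifP => iJ; last by rewrite addr0.
  by rewrite subrr.
pose g := laurent_subst (val M)^T l 'X_[m] - laurent_subst (val M)^T l f.
have gu : peval g u != 0.
  have gE : laurent_subst (val M)^T l 'X_[m]
      = 'X_[K, mnm_of_vec ((val M)^T *m mnmz m + l)].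
    by rewrite /laurent_subst msuppX big_seq1 mcoeffX eqxx scale1r.
  have f0 : peval (laurent_subst (val M)^T l f) u = 0.
    rewrite peval_sum big1_seq // => k /andP[_ /(msupp_laurent_subst lf)[k' k'f kE]].
    have [_ [i iJ ik']] := Pf k' k'f.
    rewrite /monomial_value (bigD1 i) //= kE [u i 0](uJ i).2 // mxE lE iJ.
    by rewrite exp0rz gt_eqF ?mul0r ?mulr0 //; move: ik'; rewrite mulmxBr !mxE.
  rewrite /g /peval mevalB -!/(peval _ u) f0 subr0 gE pevalX mnm_of_vecK; last first.
    by apply: lm; rewrite msuppX mem_head.
  apply/prodf_neq0 => i _; have [iJ|iJ] := boolP (i \in J).
    by rewrite mxE lE iJ subrr expr0z oner_neq0.
  by rewrite expfz_neq0 //; apply: contra iJ => /eqP/uJ.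
suff sub : @toric_modification R K n Sigma @^-1` (zero_set I `\` zero_set [set \prod_(i < n) 'X_i])
    `<=` ~` (chart_incl M @` [set v | peval g v != 0]).
  move=> /(_ _ (conj (toric_closed_compl M g) sub)); apply.
  by exists u.
move=> x [/= xI /torusP xt] [v /eqP gv vx]; apply: gv.
rewrite -vx toric_modificationE // in xI xt.
have tv : torus v.
  by apply: torus_of_monomial_map xt => //; rewrite unitmx_tr chart_unit.
rewrite /g /peval mevalB -!/(peval _ v) !peval_laurent_subst // -mulrBr.
rewrite (_ : _ - _ = peval ('X_[m] - f) (monomial_map (val M)^T v)); last first.
  by rewrite /peval mevalB.
by rewrite xI // mulr0.
Qed.
End MissedOrbit.

(** * Realization of preorders by real weights *)

Section RationalPoint.
Variable n : nat.
Local Notation ratmx := (map_mx (intr : int -> rat)).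

Lemma clear_denominators m k (A : 'M[rat]_(m, k)) :
  exists d (B : 'M[int]_(m, k)), (0 < d)%N /\ d%:R *: A = ratmx B.
Proof.
pose d := \prod_(ij : 'I_m * 'I_k) denq (A ij.1 ij.2).
have d0 : 0 < d by apply: prodr_gt0 => ij _; exact: denq_gt0.
exists (absz d), (\matrix_(i, j)
  (numq (A i j) * \prod_(ij | ij != (i, j)) denq (A ij.1 ij.2))).
split; first by rewrite absz_gt0 gt_eqF.
apply/matrixP => i j; rewrite !mxE pmulrn gez0_abs ?ltW // /d (bigD1 (i, j)) //=.
by rewrite !intrM mulrC mulrA numqE.
Qed.

Lemma ratmx_inj m k : injective (fun A : 'M[int]_(m, k) => ratmx A).
Proof. by move=> A B /matrixP AB; apply/matrixP => i j; have := AB i j; rewrite !mxE => /intr_inj. Qed.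

(** A family in [E] of maximal rank spans [E] over the rationals; it replaces the possibly infinite
    [E] by a matrix to which Gordan's theorem applies. *)
Lemma max_rank_family (E : set 'cV[int]_n) : exists l (W : 'M[int]_(n, l)),
  (forall j, E (col j W)) /\ forall e, E e -> exists d : 'cV_l, ratmx e = ratmx W *m d.
Proof.
pose ok r := exists l (W : 'M[int]_(n, l)), (forall j, E (col j W)) /\ \rank (ratmx W) = r.
have ex : exists r, `[< ok r >].
  by exists 0%N; apply/asboolP; exists 0%N, 0; split=> [[]//|]; rewrite map_mx0 mxrank0.
have bd r : `[< ok r >] -> (r <= n)%N.
  by move=> /asboolP[l [W [_ <-]]]; exact: rank_leq_row.
case: (ex_maxnP ex bd) => r /asboolP[l [W [EW rW]]] maxr.
exists l, W; split=> // e Ee.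
pose C := col_mx (ratmx W)^T (ratmx e)^T.
have /andP[WC eC] : ((ratmx W)^T <= C)%MS && ((ratmx e)^T <= C)%MS by rewrite -col_mx_sub.
have rC : (\rank C <= \rank (ratmx W)^T)%N.
  rewrite mxrank_tr rW; apply: maxr; apply/asboolP; exists (l + 1)%N, (row_mx W e); split.
    move=> j; case: (split_ordP j) => i ->; first by rewrite colKl.
    by rewrite colKr col_id.
  by rewrite -mxrank_tr map_row_mx tr_row_mx.
have /submxP[d dE] : ((ratmx e)^T <= (ratmx W)^T)%MS.
  by apply: submx_trans eC _; rewrite -(mxrank_leqif_sup WC).2 eqn_leq rC mxrankS.
by exists d^T; apply: trmx_inj; rewrite dE trmx_mul trmxK.
Qed.
End RationalPoint.

Section PreorderRealization.
Variables (R : realType) (n : nat).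
Local Notation ratmx := (map_mx (intr : int -> rat)).
Variables P E : set 'cV[int]_n.
Hypothesis hPE : total_preorder P E.

Lemma equiv_comb l (W : 'M[int]_(n, l)) (d : 'cV_l) : (forall j, E (col j W)) -> E (W *m d).
Proof.
move=> EW.
have Emul a (i : int) : E a -> E (a *~ i).
  move=> Ea; have En k : E (a *+ k).
    elim: k => [|k IH]; first by rewrite mulr0n; exact: (equiv0 hPE).
    by rewrite mulrS; exact: (equivD hPE).
  by case: i => k; [exact: En | apply: (equivN hPE); exact: En].
have -> : W *m d = \sum_j col j W *~ d j 0.
  apply/colP => i; rewrite summxE mxE; apply: eq_bigr => j _.
  by rewrite -scaler_int !mxE mulrC intz.
apply: (big_ind E); [exact: (equiv0 hPE) | exact: (equivD hPE) | by move=> j _; exact: Emul].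
Qed.

Lemma pos_comb k (B : 'M[int]_(n, k)) (c : 'cV_k) : (forall j, P (col j B)) ->
  (forall j, 0 <= c j 0) -> c != 0 -> P (B *m c).
Proof.
move=> PB c0 cn0.
have Pmul a (i : int) : P a -> 0 < i -> P (a *~ i).
  move=> Pa; case: i => // -[//|p] _; elim: p => [//|p IH].
  by rewrite -pmulrn mulrS; exact: (posD hPE).
have [j cj] : exists j, c j 0 != 0.
  apply/existsP; apply: contraNT cn0 => /existsPn cj0.
  by apply/eqP/colP => j; rewrite [RHS]mxE; apply/eqP/negPn/cj0.
have -> : B *m c = \sum_j col j B *~ c j 0.
  apply/colP => i; rewrite summxE mxE; apply: eq_bigr => l _.
  by rewrite -scaler_int !mxE mulrC intz.
have Pc l : c l 0 != 0 -> P (col l B *~ c l 0).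
  by move=> cl; apply: Pmul => //; rewrite lt_def cl c0.
have P0 x : x = 0 \/ P x -> forall y, P y -> P (x + y).
  by move=> [->|Px] y Py; [rewrite add0r | exact: (posD hPE)].
rewrite (bigD1 j) //= addrC; apply: (P0); last exact: Pc.
apply: (big_ind (fun x => x = 0 \/ P x)); first by left.
  by move=> x y Px [->|Py]; [rewrite addr0 | right; exact: P0].
move=> l _; have [->|/Pc] := eqVneq (c l 0) 0; last by right.
by left; rewrite mulr0z.
Qed.

(* Gordan's theorem over the rationals: a relation between the given positive
   vectors modulo E would make a positive vector equivalent to 0. *)
Lemma preorder_realization (L : seq 'cV[int]_n) : (forall a, a \in L -> P a) ->
  exists w : 'cV[R]_n, (forall a, a \in L -> 0 < dotv w (Defs.realmx R a)) /\
    forall e, E e -> dotv w (Defs.realmx R e) = 0.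
Proof.
move=> PL; have [l [W [EW WE]]] := max_rank_family E.
pose B := \matrix_(i < n, j < size L) (nth 0 L j) i 0.
have Bcol j : col j B = nth 0 L j by apply/colP => i; rewrite !mxE.
have PB j : P (col j B) by rewrite Bcol; apply/PL/mem_nth.
have dotE (w : 'rV[rat]_n) (a : 'cV[int]_n) :
    dotv (map_mx ratr w)^T (Defs.realmx R a) = ratr ((w *m ratmx a) 0 0).
  rewrite /dotv mxE rmorph_sum; apply: eq_bigr => i _.
  by rewrite !mxE rmorphM /= ratr_int.
have [[w wW wB]|[c [c0 cn0 [d Bc]]]] := gordan (ratmx W) (ratmx B).
  exists (map_mx ratr w)^T; split=> [a aL|e /WE[d eE]]; rewrite dotE.
    rewrite ltr0q; have jL : (index a L < size L)%N by rewrite index_mem.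
    have aB : col (Ordinal jL) B = a by rewrite Bcol /= nth_index.
    suff -> : w *m ratmx a = col (Ordinal jL) (w *m ratmx B) by rewrite mxE.
    by rewrite -[in LHS]aB map_col !colE mulmxA.
  by rewrite eE mulmxA wW mul0mx mxE rmorph0.
exfalso; have [N [cd [N0 cdE]]] := clear_denominators (col_mx c d).
rewrite -[cd]vsubmxK scale_col_mx map_col_mx in cdE.
have [cE dE] := eq_col_mx cdE; move: (usubmx cd) (dsubmx cd) cE dE => c' d' cE dE.
have BcE : B *m c' = W *m d'.
  by apply: ratmx_inj; rewrite !map_mxM /= -cE -dE -!scalemxAr Bc.
have : P (B *m c').
  apply: pos_comb => // [j|].
    have /colP/(_ j) := cE; rewrite !mxE => e.
    by rewrite -(ler0z rat) -e mulr_ge0 // ler0n.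
  apply: contraNneq cn0 => c'0; move: cE; rewrite c'0 map_mx0 => /eqP.
  by rewrite scaler_eq0 pnatr_eq0 gtn_eqF.
have /(equivN hPE) := equiv_comb d' EW; rewrite -BcE => EB PBc.
by apply: (pos0 hPE); rewrite -(addNr (B *m c')); exact: (equiv_posD hPE).
Qed.
End PreorderRealization.

(** * A tropical point in the relative interior of a face *)

Section TropicalPoint.
Variables (R : realType) (K : fieldType) (n : nat).

(** The coordinates of [w] in the basis [M] are its products with the exponents [y i] of the chart
    coordinates. For [i] in [J] these join the list of strict inequalities; the others lie in [U],
    hence in [E], where [w] vanishes. *)
Lemma tropical_of_irreducible (I : set {mpoly K[n]}) (M : 'M[int]_n) J :
  is_ideal I -> M \in unitmx -> ~ reducible I (face_pos M J) ->
  exists c : 'cV[R]_n, [/\ forall i, i \in J -> 0 < c i 0,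
    forall i, i \notin J -> c i 0 = 0 & tropical_variety R I (Defs.realmx R M *m c)].
Proof.
move=> hI uM red.
pose U : set 'cV[int]_n := [set a | forall i, i \in J -> (M^T *m a) i 0 = 0].
have [|||P [E [P0P UE redP hPE]]] := @maximal_preorder _ _ _ hI _ U _ _ _ red.
- by move=> u Uu i iJ; rewrite mulmxN mxE Uu // oppr0.
- move=> a b [a0 [i iJ ai]] [b0 _]; split; rewrite mulmxDr; last first.
    by exists i; rewrite // mxE ltr_pwDl // b0.
  by move=> j jJ; rewrite mxE addr_ge0 // ?a0 ?b0.
- move=> u a Uu [a0 [i iJ ai]]; split; rewrite mulmxDr.
    by move=> j jJ; rewrite mxE Uu // add0r a0.
  by exists i; rewrite // mxE Uu // add0r.
have [F [FP Ftrop]] := preorder_tropical hI hPE redP R.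
pose y i := col i (invmx M)^T.
have yE i : M^T *m y i = delta_mx i 0.
  by rewrite /y colE mulmxA -trmx_mul mulVmx // trmx1 mul1mx.
have [|w [wL wE]] := @preorder_realization R _ _ _ hPE (F ++ [seq y i | i <- enum J]).
  move=> a; rewrite mem_cat => /orP[/FP//|/mapP[i]]; rewrite mem_enum => iJ ->.
  apply: P0P; rewrite /face_pos /= yE; split=> [j _|]; first by rewrite mxE ler0n.
  by exists i; rewrite // mxE !eqxx.
have ME : Defs.realmx R M *m (Defs.realmx R (invmx M) *m w) = w.
  by rewrite mulmxA realmxKV // mul1mx.
have cE i : (Defs.realmx R (invmx M) *m w) i 0 = dotv w (Defs.realmx R (y i)).
  by rewrite mxE; apply: eq_bigr => j _; rewrite !mxE mulrC.
exists (Defs.realmx R (invmx M) *m w); rewrite ME; split=> [i iJ|i iJ|].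
- rewrite cE; apply: wL; rewrite mem_cat; apply/orP; right.
  by apply: map_f; rewrite mem_enum.
- rewrite cE; apply/wE/UE => j jJ; rewrite yE mxE; case: (eqVneq j i) => // ji.
  by move: iJ; rewrite -ji jJ.
- apply: Ftrop => [a aF|e /wE//].
  by apply/ltW/wL; rewrite mem_cat aF.
Qed.
End TropicalPoint.

(** * Initial monomials of products *)

Section InitialMonomialProduct.
Variables (R : realType) (K : fieldType) (n : nat).
Implicit Types (w : 'cV[R]_n) (f g : {mpoly K[n]}) (m k : 'X_{1..n}).

Lemma initial_monomialE w f m : initial_monomial w f m <->
  exists c g, [/\ c != 0, f = c *: 'X_[m] + g &
    forall k, k \in msupp g -> wdot w m < wdot w k].
Proof.
split=> [[fm fmin]|[c [g [c0 -> gmin]]]].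
  exists f@_m, (f - f@_m *: 'X_[m]); split=> // [|k]; first by rewrite addrC subrK.
  rewrite mcoeff_msupp mcoeffB mcoeffZ mcoeffX; have [->|mk] := eqVneq m k.
    by rewrite mulr1 subrr eqxx.
  by rewrite mulr0 subr0 -mcoeff_msupp => /fmin -> //; rewrite eq_sym.
have gm : g@_m = 0 by apply: memN_msupp_eq0; apply/negP => /gmin; rewrite ltxx.
split=> [|k]; first by rewrite mcoeffD mcoeffZ mcoeffX eqxx mulr1 gm addr0.
move=> /msuppD_le; rewrite mem_cat => /orP[/msuppZ_le/mem_msuppXP->|/gmin//].
by rewrite eqxx.
Qed.

Lemma initial_monomialX w m : initial_monomial w ('X_[m] : {mpoly K[n]}) m.
Proof.
apply/initial_monomialE; exists 1, 0; split; rewrite ?oner_neq0 // ?scale1r ?addr0 //.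
by move=> k; rewrite msupp0.
Qed.

Lemma initial_monomialM w f g m k :
  initial_monomial w f m -> initial_monomial w g k -> initial_monomial w (f * g) (m + k)%MM.
Proof.
move=> /initial_monomialE[c [f' [c0 fE f'min]]] hg.
have [d [g' [d0 gE g'min]]] := (initial_monomialE w g k).1 hg.
apply/initial_monomialE; exists (c * d), (c *: ('X_[m] * g') + f' * g); split.
- exact: mulf_neq0.
- rewrite fE mulrDl addrA; congr (_ + _).
  by rewrite gE mulrDr -!scalerAl -!scalerAr scalerA mpolyXD.
- move=> l /msuppD_le; rewrite mem_cat => /orP[/msuppZ_le|].
    move=> /msuppM_le/allpairsP[[l1 l2] /= [/mem_msuppXP <- /g'min l2g ->]].
    by rewrite !wdotD ltrD2l.
  move=> /msuppM_le/allpairsP[[l1 l2] /= [/f'min l1f l2g ->]].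
  rewrite !wdotD ltr_leD //; have [_ gmin] := hg.
  by have [->//|l2k] := eqVneq l2 k; apply/ltW/gmin.
Qed.

Lemma initial_monomialXn w f m N :
  initial_monomial w f m -> initial_monomial w (f ^+ N) (m *+ N)%MM.
Proof.
move=> fm; elim: N => [|N IH]; first by rewrite expr0 mulm0n -mpolyX0; exact: initial_monomialX.
by rewrite exprS mulmS; exact: initial_monomialM.
Qed.
End InitialMonomialProduct.

(** * Tropical cones have orbits meeting the strict transform *)

Section OrbitMet.
Variables (R : realType) (K : closedFieldType) (n : nat).

(** By contradiction, with the Nullstellensatz used twice: in the chart to produce [s], then on K^n
    to bring it back to [I]. *)
Lemma orbit_met (Sigma : set (set 'cV[R]_n)) (M : chart Sigma) (J : {set 'I_n})
    (I : set {mpoly K[n]}) :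
  fan_support Sigma = orthant R n -> is_ideal I ->
  tropical_variety R I (Defs.realmx R (val M) *m \col_i (i \in J)%:R) ->
  exists2 u : 'cV[K]_n, forall i, u i 0 = 0 <-> i \in J &
    strict_transform Sigma (zero_set I) (chart_incl M u).
Proof.
move=> suppS hI /tropical_varietyP TI; apply: contrapT => no_u.
have uM : (val M)^T \in unitmx by rewrite unitmx_tr chart_unit.
pose W := [set y : 'cV[K]_n | torus y /\ zero_set I (monomial_map (val M)^T y)].
pose S := [set s : {mpoly K[n]} | forall y, W y -> peval s y = 0].
have pevalD f g (y : 'cV[K]_n) : peval (f + g) y = peval f y + peval g y by exact: mevalD.
have pevalM f g (y : 'cV[K]_n) : peval (f * g) y = peval f y * peval g y by exact: mevalM.
(* A zero of [S] lies in every closed set of the chart containing [W], hence in the strict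
   transform. *)
have S_u u : zero_set S u -> ~ forall i, u i 0 = 0 <-> i \in J.
  move=> Su uJ; apply: no_u; exists u => // Z [Zc Zs].
  have [S' ZE] := Zc M; suff : (chart_incl M @^-1` Z) u by [].
  rewrite ZE => s S's; apply: Su => y [ty Vy].
  have : (chart_incl M @^-1` Z) y.
    apply: Zs; rewrite /= toric_modificationE //; split=> //.
    by apply/torusP; exact: torus_monomial_map.
  by rewrite ZE; apply.
pose Q := [set f | exists2 s, S s & exists b : 'I_n -> {mpoly K[n]},
  f = s + \sum_(i in J) b i * 'X_i].
have hQ : is_ideal Q.
  split.
  - exists 0; first by move=> y _; rewrite /peval meval0.
    by exists (fun=> 0); rewrite big1 ?addr0 // => i _; rewrite mul0r.
  - move=> f g [s Ss [b ->]] [t St [c ->]]; exists (s + t).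
      by move=> y Wy; rewrite pevalD Ss // St // addr0.
    exists (fun i => b i + c i); rewrite addrACA; congr (_ + _).
    by rewrite -big_split; apply: eq_bigr => i _; rewrite mulrDl.
  - move=> f g [s Ss [b ->]]; exists (f * s).
      by move=> y Wy; rewrite pevalM Ss // mulr0.
    exists (fun i => f * b i); rewrite mulrDr mulr_sumr; congr (_ + _).
    by apply: eq_bigr => i _; rewrite mulrA.
(* The product of the [y_i] with [i] outside [J]; zeros of [Q] where it is nonzero would lie in the
   orbit. *)
pose e : 'X_{1..n} := [multinom nat_of_bool (i \notin J) | i < n].
have [z Qz|N [s Ss [b hE]]] := @nullstellensatz _ _ Q 'X_[e] hQ.
  rewrite pevalX; apply/eqP/negPn/negP => /prodf_neq0 ez.
  apply: (S_u z).
    move=> s Ss; apply: Qz; exists s => //; exists (fun=> 0).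
    by rewrite big1 ?addr0 // => i _; rewrite mul0r.
  move=> i; split=> [zi|iJ].
    apply/negPn/negP => iJ; have := ez i isT.
    by rewrite mxE mnmE iJ zi expr1z eqxx.
  rewrite -(_ : peval 'X_i z = z i 0); last exact: mevalXU.
  apply: Qz; exists 0; first by move=> y _; rewrite /peval meval0.
  exists (fun j => (j == i)%:R); rewrite add0r (bigD1 i) //= eqxx mul1r.
  by rewrite big1 ?addr0 // => j /andP[_ /negPf->]; rewrite mul0r.
rewrite mpolyXn in hE; set k0 := (e *+ N)%MM in hE.
have k0J i : i \in J -> k0 i = 0%N by move=> iJ; rewrite mulmnE mnmE iJ.
(* The sum over [J] contributes only terms divisible by some [y_i] with [i] in [J]. *)
have s_coef (k : 'X_{1..n}) : (forall i, i \in J -> k i = 0%N) -> s@_k = (k0 == k)%:R.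
  move=> kJ; rewrite -mcoeffX hE mcoeffD raddf_sum /= big1 ?addr0 // => i iJ.
  rewrite mcoeffMXE; case: ifP => // /mnm_lepP/(_ i).
  by rewrite mnm1E eqxx kJ.
have s_pos (k : 'X_{1..n}) : k \in msupp s -> k != k0 -> exists2 i, i \in J & (0 < k i)%N.
  rewrite mcoeff_msupp => sk kk0; apply: contrapT => nk; move: sk.
  rewrite s_coef ?[k0 == k]eq_sym ?(negPf kk0) ?eqxx // => i iJ.
  by apply/eqP; rewrite -leqn0 leqNgt; apply/negP => ki; apply: nk; exists i.
have k0s : k0 \in msupp s by rewrite mcoeff_msupp s_coef // eqxx oner_neq0.
pose B := invmx (val M)^T.
(* Large enough to clear all negative exponents. *)
pose l : 'cV[int]_n := \col_i \sum_(k <- msupp s) `|(B *m mnmz k) i 0|.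
have Bl (k : 'X_{1..n}) : k \in msupp s -> forall i, 0 <= (B *m mnmz k + l) i 0.
  move=> ks i; rewrite mxE [l i 0]mxE (bigD1_seq k) ?msupp_uniq //= addrA.
  rewrite addr_ge0 ?sumr_ge0 // -[X in X + _]opprK addrC subr_ge0.
  by rewrite ler_normr lexx orbT.
pose G := laurent_subst B l s; pose m0 := mnm_of_vec (B *m mnmz k0 + l).
have m0E : mnmz m0 = B *m mnmz k0 + l by rewrite mnm_of_vecK //; exact: Bl.
pose w : 'cV[R]_n := Defs.realmx R (val M) *m \col_i (i \in J)%:R.
(* The weight [w] measures the total exponent in the [y_i] with [i] in [J]. *)
have wE (k k' m m' : 'X_{1..n}) : mnmz m = B *m mnmz k + l -> mnmz m' = B *m mnmz k' + l ->
    wdot w m - wdot w m' = \sum_(i in J) ((k i)%:R - (k' i)%:R).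
  move=> mE m'E; rewrite !wdotE.
  have -> : dotv w (Defs.realmx R (mnmz m)) - dotv w (Defs.realmx R (mnmz m'))
      = (w^T *m Defs.realmx R (mnmz m - mnmz m')) 0 0.
    rewrite /dotv -sumrB mxE; apply: eq_bigr => i _.
    by rewrite !mxE -mulrBr -intrB.
  have -> : mnmz m - mnmz m' = B *m (mnmz k - mnmz k').
    by rewrite mE m'E mulmxBr opprD addrACA subrr addr0.
  rewrite realmxM /w trmx_mul mulmxA -(mulmxA _ _ (Defs.realmx R B)).
  have -> : (Defs.realmx R (val M))^T *m Defs.realmx R B = 1%:M.
    rewrite -(realmxKV R uM); congr (_ *m _).
    by apply/matrixP => i j; rewrite !mxE.
  rewrite mulmx1 mxE [RHS]big_mkcond; apply: eq_bigr => i _.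
  rewrite !mxE; case: (i \in J); rewrite ?mul0r // mul1r.
  by rewrite intrB.
have Gm0 : initial_monomial w G m0.
  split.
    rewrite (@mcoeff_laurent_subst _ _ _ _ _ _ k0) // -?mcoeff_msupp // => k ks.
    rewrite m0E => /addIr BE; apply: mnmz_inj.
    by rewrite -[mnmz k](mulKVmx uM) BE mulKVmx.
  move=> m /(msupp_laurent_subst Bl)[k ks mE] mm0; rewrite -subr_gt0 (wE _ _ _ _ mE m0E).
  have kk0 : k != k0.
    by apply: contraNneq mm0 => kk0; apply/eqP/mnmz_inj; rewrite mE m0E kk0.
  have [i iJ ki] := s_pos k ks kk0.
  rewrite (bigD1 i) //= k0J // subr0 ltr_pwDl ?ltr0n //.
  by apply: sumr_ge0 => j /andP[jJ _]; rewrite k0J // subr0 ler0n.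
(* The factor [x_1 ... x_n] makes the product vanish off the torus, where [G] is not controlled. *)
pose e1 : 'X_{1..n} := [multinom 1%N | i < n].
have [x Ix|N' IG] := @nullstellensatz _ _ I (G * 'X_[e1]) hI.
  rewrite pevalM; have [tx|] := pselect (torus x).
    rewrite peval_laurent_subst // Ss ?mulr0 ?mul0r //.
    split; first exact: torus_monomial_map.
    by rewrite monomial_mapM // mulVmx // monomial_map1.
  move=> /existsNP[i /negP/negPn/eqP xi].
  by rewrite pevalX /monomial_value (bigD1 i) //= xi mxE mnmE expr1z mul0r mulr0.
apply: (TI hI _ ((m0 + e1) *+ N')%MM IG); apply: initial_monomialXn.
by apply: initial_monomialM Gm0 _; exact: initial_monomialX.
Qed.
End OrbitMet.

(** * From a relative interior point to the whole cone, and the equivalence *)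

Section TropicalFaces.
Variables (R : realType) (K : closedFieldType) (n : nat).
Variables (I : set {mpoly K[n]}) (Sigma : set (set 'cV[R]_n)).
Hypotheses (hI : is_ideal I)
  (hSigma : regular_refinement (groebner_fan R I) Sigma)
  (hsupp : fan_support Sigma = orthant R n).

(** The refinement gives a cone [D] of [Sigma] through the interior point [w] inside the Gröbner
    cone of [w]; [fan_subset] puts [tau] in [D], and that Gröbner cone is tropical. *)
Lemma tropical_face tau k (A : 'M[R]_(n, k)) (J : {set 'I_k}) (c : 'cV_k) :
  Sigma tau -> tau = subcone A J ->
  (forall i, i \in J -> 0 < c i 0) -> (forall i, i \notin J -> c i 0 = 0) ->
  tropical_variety R I (A *m c) -> tau `<=` tropical_variety R I.
Proof.
move=> Stau tauE c0 cJ Tw; have [fan _ refine] := hSigma; set w := A *m c in Tw.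
have tau_w : tau w.
  rewrite tauE; apply/subconeP; exists c; split=> // i.
  by have [/c0/ltW|/cJ->] := boolP (i \in J).
have orth_w : orthant R n w by rewrite -hsupp; exists tau.
have [|T TS CE] := refine (groebner_cone I w `&` subcone 1%:M [set: 'I_n]%SET).
  by exists w, [set: 'I_n]%SET.
have : (groebner_cone I w `&` subcone 1%:M [set: 'I_n]%SET) w.
  by split; [exact: groebner_cone_refl | rewrite subcone1T].
rewrite CE => -[D TD Dw] u /(fan_subset fan Stau (TS D TD) tauE c0 cJ Dw) Du.
apply: (groebner_cone_tropical hI Tw).
suff : (groebner_cone I w `&` subcone 1%:M [set: 'I_n]%SET) u by case.
by rewrite CE; exists D.
Qed.
End TropicalFaces.

Theorem theorem13p2 (R : realType) (K : closedFieldType) (n : nat)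
    (I : set {mpoly K[n]}) (Sigma : set (set 'cV[R]_n))
    (hI : is_ideal I)
    (hSigma : regular_refinement (groebner_fan R I) Sigma)
    (hsupp : fan_support Sigma = orthant R n)
    (tau : set 'cV[R]_n) (htau : Sigma tau) :
  (strict_transform Sigma (zero_set I) `&` toric_orbit K Sigma tau !=set0)
  <-> tau `<=` tropical_variety R I.
Proof.
have [fan reg _] := hSigma; split=> [[x [xV [M [J [u [tauE uJ xE]]]]]]|tauT].
  have [|c [c0 cJ Tc]] := @tropical_of_irreducible R _ _ _ (val M) J hI (chart_unit M).
    by move=> red; apply: (reducible_missed hsupp uJ red); rewrite -xE.
  exact: (tropical_face hI hSigma hsupp htau tauE c0 cJ Tc).
have [M [J [uM SM tauE]]] := exists_chart fan reg hsupp htau.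
have chartM : is_chart Sigma M by rewrite /is_chart uM; apply/asboolP.
have [|u uJ uV] := @orbit_met R K n Sigma (Sub M chartM) J I hsupp hI.
  apply: tauT; rewrite tauE; apply/subconeP; exists (\col_i (i \in J)%:R); split=> // i.
    by rewrite mxE ler0n.
  by rewrite mxE => /negPf->.
exists (chart_incl (Sub M chartM) u); split=> //.
by exists (Sub M chartM), J, u.
Qed.
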